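(* For every integer $n\geq 60$, the $n$-cube $Q_n$ has four pairwise almost-orthogonal symmetric chain decompositions, and consequently $Q_n$ has four pairwise orthogonal chain decompositions.
   Context: The $n$-cube $Q_n$ is the poset of all subsets of $[n]=\{1,\dots,n\}$ ordered by inclusion; its $k$th level is the family of $k$-element subsets, and its width is $a_n=\binom{n}{\lfloor n/2\rfloor}$. A chain is symmetric if its minimal and maximal elements lie on levels $k$ and $n-k$ for some $k$, and saturated if it contains an element on every level between these. A symmetric chain decomposition (SCD) of $Q_n$ is a partition of $Q_n$ into $a_n$ symmetric saturated chains (such a decomposition has a unique chain of size $n+1$). Two SCDs of $Q_n$ are almost-orthogonal if any chain of the first and any chain of the second share at most one element, except that the two unique chains of size $n+1$ may share exactly the two elements $\emptyset$ and $[n]$ (and no others). Two decompositions of $Q_n$ into $a_n$ (not necessarily symmetric or saturated) chains are orthogonal if any chain of the first and any chain of the second share at most one element. *)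

(* Defs.v *)
(* The n-cube Q_n is the type {set 'I_n} ordered by \subset
   (the ground set [n] is 'I_n); a family of subsets is a {set {set 'I_n}}. *)
From mathcomp Require Import all_boot.

Set Implicit Arguments.
Unset Strict Implicit.
Unset Printing Implicit Defensive.

Definition level (n k : nat) : {set {set 'I_n}} :=
  [set A : {set 'I_n} | #|A| == k].
Arguments level : clear implicits.

Definition is_chain n (C : {set {set 'I_n}}) : Prop :=
  {in C &, forall A B : {set 'I_n}, (A \subset B) || (B \subset A)}.

Definition symmetric_chain n (C : {set {set 'I_n}}) : Prop :=
  is_chain C /\
  exists (k : nat) (A B : {set 'I_n}),
    [/\ k <= n, minset (mem C) A, maxset (mem C) B,
        A \in level n k & B \in level n (n - k)].

Definition saturated_chain n (C : {set {set 'I_n}}) : Prop :=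
  is_chain C /\
  forall A B : {set 'I_n}, minset (mem C) A -> maxset (mem C) B ->
  forall m, #|A| <= m <= #|B| -> exists2 X, X \in C & X \in level n m.

Definition chain_decomposition n (D : {set {set {set 'I_n}}}) : Prop :=
  [/\ partition D [set: {set 'I_n}],
      #|D| = 'C(n, n./2)
    & {in D, forall C : {set {set 'I_n}}, is_chain C}].

Definition symmetric_chain_decomposition n (D : {set {set {set 'I_n}}}) : Prop :=
  [/\ partition D [set: {set 'I_n}],
      #|D| = 'C(n, n./2)
    & {in D, forall C : {set {set 'I_n}}, symmetric_chain C /\ saturated_chain C}].

Definition orthogonal n (D1 D2 : {set {set {set 'I_n}}}) : Prop :=
  {in D1 & D2, forall C1 C2 : {set {set 'I_n}}, #|C1 :&: C2| <= 1}.

Definition almost_orthogonal n (D1 D2 : {set {set {set 'I_n}}}) : Prop :=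
  {in D1 & D2, forall C1 C2 : {set {set 'I_n}},
    #|C1 :&: C2| <= 1 \/
    [/\ #|C1| = n.+1, #|C2| = n.+1
      & C1 :&: C2 = [set set0; [set: 'I_n]]]}.

(* Main.v *)
Require Import Defs.
From mathcomp Require Import all_boot.
From Stdlib Require Import NArith.
From mathcomp Require Import zify.

(** Almost-orthogonal families of SCDs multiply. The product of a chain C of
    Q_m and a chain D of Q_n is a grid, which is cut into symmetric chains by
    peeling off hooks (a full row followed by a full column, or the reverse).
    Two product chains with different indices can share more than one element
    only along a line of the grid, in the direction of a factor that is a full
    chain from the empty set to the full set. Exchanging the end points of the
    first two hooks, when both have the same shape, destroys all such full lines.
    This is impossible when the other factor has at most two elements; then one
    full line remains, but it can be chosen freely. So one keeps a colouring of
    each cube by the indices of the SCDs, in which every chain of the i-th SCD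
    with at most two elements contains an element of colour i, and puts the full
    line over such an element: for different i these lines are disjoint.

    If every chain (not only the small ones) of the i-th SCD of Q_n meets colour
    i, then small chains of the product can be made to pass through colour i in
    the second factor, so Q_(m+n) has such a colouring too. This holds for
    explicit SCDs of Q_11 and, by an explicit colouring, of Q_14 = Q_7 x Q_7.
    For Q_7 it fails by counting, so Q_7 only enters as the last factor. Every
    n >= 60 is of the form 14 a + 11 b or 14 a + 11 b + 7.

    For the orthogonal chain decompositions, the top element of each SCD is moved
    to a further chain, these chains being chosen pairwise disjoint. *)

Set Implicit Arguments.
Unset Strict Implicit.
Unset Printing Implicit Defensive.

(** * Symmetric chains of a grid *)

Definition but_last (T : Type) (s : seq T) : seq T :=
  if s is x :: s' then belast x s' else [::].

Definition swap (T U : Type) (z : T * U) : U * T := (z.2, z.1).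

Definition hook (T U : Type) (C : seq T) (D : seq U) : seq (T * U) :=
  if C is c :: C' then
    if D is d :: D' then [seq (x, d) | x <- C] ++ [seq (last c C', y) | y <- D']
    else [::]
  else [::].

(* Letter [true] of [w] peels off the row of the first element of D and then the
   column of the last element of C; letter [false] peels off the column of the
   first element of C and then the row of the last element of D. What is left
   after the last letter is a single row or column. *)
Fixpoint hooks (T U : Type) (w : seq bool) (C : seq T) (D : seq U) :
    seq (seq (T * U)) :=
  match w with
  | [::] => [:: hook C D]
  | true :: w' => hook C D :: hooks w' (but_last C) (behead D)
  | false :: w' => map (@swap U T) (hook D C) :: hooks w' (behead C) (but_last D)
  end.

(* If the first two hooks have the same shape, then after exchanging their end
   points neither of them contains a full row or a full column of the grid. *)
Definition swap_ends (T : Type) (H : seq (seq T)) : seq (seq T) :=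
  if H is (x :: K) :: L :: H' then
    (x :: rcons L (last x K)) :: but_last K :: H'
  else H.

Section Hooks.
Variables T U : eqType.
Implicit Types (C : seq T) (D : seq U) (w : seq bool).

Lemma size_but_last (A : Type) (s : seq A) : size (but_last s) = (size s).-1.
Proof. by case: s => //= x s; rewrite size_belast. Qed.

Lemma but_last_rcons (A : Type) (s : seq A) x : but_last (rcons s x) = s.
Proof. by case: s => //= y s; rewrite belast_rcons. Qed.

Lemma size_hook C D : 0 < size C -> 0 < size D ->
  size (hook C D) = (size C + size D).-1.
Proof. by case: C D => [|c C] [|d D] //= _ _; rewrite size_cat !size_map; lia. Qed.

Lemma swapK (A B : Type) : cancel (@swap A B) (@swap B A).
Proof. by case. Qed.

(** One letter per peeled hook: after [size w] letters the shorter side has a single element left,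
    so the final [hook] fills the rest of the grid. *)
Definition grid_spec w C D :=
  [&& 0 < size C, 0 < size D & size w == (minn (size C) (size D)).-1].

Lemma grid_spec_true w C D : grid_spec (true :: w) C D ->
  grid_spec w (but_last C) (behead D).
Proof. rewrite /grid_spec size_but_last size_behead /=; lia. Qed.

Lemma grid_spec_false w C D : grid_spec (false :: w) C D ->
  grid_spec w (behead C) (but_last D).
Proof. rewrite /grid_spec size_but_last size_behead /=; lia. Qed.

Lemma allpairs_nil C : [seq (x, y) | x <- C, y <- [::] : seq U] = [::].
Proof. by elim: C. Qed.

Lemma perm_hook C D :
  perm_eq (hook C D ++ [seq (x, y) | x <- but_last C, y <- behead D])
          [seq (x, y) | x <- C, y <- D].
Proof.
case: D => [|d D]; first by case: C => [|c C] //; rewrite !allpairs_nil.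
case/lastP: C => [|C c] //; rewrite but_last_rcons perm_sym.
apply: perm_trans (_ : perm_eq _ ([seq (x, d) | x <- rcons C c] ++ _)) _.
  by apply/permPl/perm_allpairs_consr.
have -> : hook (rcons C c) (d :: D) =
    [seq (x, d) | x <- rcons C c] ++ [seq (c, y) | y <- D].
  by case: C => //= x C; rewrite last_rcons.
by rewrite -catA perm_cat2l /= allpairs_rcons perm_catC.
Qed.

Lemma perm_allpairs_swap C D :
  perm_eq (map (@swap U T) [seq (y, x) | y <- D, x <- C])
          [seq (x, y) | x <- C, y <- D].
Proof.
elim: D => [|d D IH] /=; first by elim: C.
rewrite map_cat -map_comp perm_sym.
apply: perm_trans (_ : perm_eq _ ([seq (x, d) | x <- C] ++ _)) _.
  by apply/permPl/perm_allpairs_consr.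
by rewrite perm_cat2l perm_sym.
Qed.

End Hooks.

Lemma perm_hooks (T U : eqType) w (C : seq T) (D : seq U) : grid_spec w C D ->
  perm_eq (flatten (hooks w C D)) [seq (x, y) | x <- C, y <- D].
Proof.
elim: w C D => [|b w IH] C D spec.
  rewrite /= cats0; apply: perm_trans (perm_hook C D).
  have /orP[/eqP C0|/eqP D0] : (but_last C == [::]) || (behead D == [::]).
    by rewrite -!size_eq0 size_but_last size_behead; move: spec => /and3P[] /=; lia.
  - by rewrite C0 /= cats0.
  - by rewrite D0 allpairs_nil cats0.
case: b spec => [/grid_spec_true/IH H|/grid_spec_false/IH H] /=.
  by apply: perm_trans (perm_hook C D); rewrite perm_cat2l.
apply: perm_trans (perm_allpairs_swap _ _).
have := perm_map (@swap U T) (perm_hook D C); rewrite perm_sym => H1.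
rewrite perm_sym; apply: perm_trans H1 _.
rewrite map_cat perm_cat2l perm_sym; apply: perm_trans H _.
by rewrite perm_sym perm_allpairs_swap.
Qed.

Lemma swap_ends_map (A B : Type) (f : A -> B) (H : seq (seq A)) :
  swap_ends (map (map f) H) = map (map f) (swap_ends H).
Proof.
case: H => [|[|x K] [|L H]] //=; rewrite map_rcons last_map.
by case: K => //= y K; rewrite belast_map.
Qed.

(** Transposing the grid interchanges the two kinds of hooks. The last hook has the same form on
    both sides, which agrees because the remaining grid is a line. *)
Lemma hooks_swap (T U : eqType) (w : seq bool) (C : seq T) (D : seq U) :
  grid_spec w C D ->
  hooks (map negb w) D C = map (map (@swap T U)) (hooks w C D).
Proof.
elim: w C D => [|b w IH] C D spec.
  case/and3P: spec; case: C => [|c C] // _; case: D => [|d D] // _ /eqP spec.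
  have /orP[/nilP-> | /nilP->] : nilp C || nilp D by rewrite /nilp; move: spec => /=; lia.
    by rewrite /= !cats0 -!map_comp.
  by rewrite /= !cats0 -!map_comp.
case: b spec => [/grid_spec_true/IH|/grid_spec_false/IH] /= -> //.
by rewrite mapK //; apply: swapK.
Qed.

Definition starts_twice (w : seq bool) : bool :=
  if w is b :: b' :: _ then b == b' else false.

Lemma starts_twice_negb w : starts_twice (map negb w) = starts_twice w.
Proof. by case: w => [|[] [|[] w]]. Qed.

Definition grid (T U : Type) (w : seq bool) (C : seq T) (D : seq U) :=
  if starts_twice w then swap_ends (hooks w C D) else hooks w C D.

Lemma grid_swap (T U : eqType) w (C : seq T) (D : seq U) :
  grid_spec w C D ->
  grid (map negb w) D C = map (map (@swap T U)) (grid w C D).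
Proof.
move=> /hooks_swap wCD; rewrite /grid starts_twice_negb wCD.
by case: ifP => // _; rewrite swap_ends_map.
Qed.

Lemma grid_spec_swap (T U : eqType) w (C : seq T) (D : seq U) :
  grid_spec w C D -> grid_spec (map negb w) D C.
Proof. by case/and3P=> *; apply/and3P; split; rewrite // size_map minnC. Qed.

Lemma mem_map_swap (T U : eqType) (x : T) (y : U) s :
  ((y, x) \in map (@swap T U) s) = ((x, y) \in s).
Proof. by rewrite -[(y, x)]/(swap (x, y)) mem_map //; apply: can_inj (@swapK _ _). Qed.

(** A first hook with a single element would be duplicated by [swap_ends], hence the size
    condition. *)
Lemma perm_swap_ends (A : eqType) (H : seq (seq A)) : 1 < size (head [::] H) ->
  perm_eq (flatten (swap_ends H)) (flatten H).
Proof.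
case: H => [|[|x [|y K]] [|L H]] //= _.
rewrite perm_cons cat_rcons -[last y K :: _ ++ _]/((last y K :: belast y K) ++ _).
rewrite -[y :: K ++ _]/((y :: K) ++ _) perm_catCA perm_cat2r.
by rewrite [in X in perm_eq _ X]lastI perm_sym perm_rcons.
Qed.

(** * Symmetry and saturation of the chains of a grid *)

(** [N] is the rank sum of the two ends. It stays a parameter because the truncated chains that
    arise while peeling are symmetric about shifted levels. *)
Definition sym_chain (A : Type) (e : rel A) (r : A -> nat) N (s : seq A) :=
  if s is x :: s' then path e x s' && (r x + r (last x s') == N) else false.

Section SymChain.
Variables (A : Type) (e : rel A) (r : A -> nat).
Hypothesis e_rank : forall x y, e x y -> r y = (r x).+1.

Lemma sym_chain_behead N s : 1 < size s ->
  sym_chain e r N s -> sym_chain e r N.+1 (behead s).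
Proof.
case: s => [|x [|y s]] //= _ /andP[/andP[/e_rank exy ->] /eqP<-].
by rewrite exy addSn eqxx.
Qed.

Lemma sym_chain_but_last N s : 1 < size s ->
  sym_chain e r N s -> 0 < N /\ sym_chain e r N.-1 (but_last s).
Proof.
case: s => [|x s] //; case/lastP: s => [|s y] // _.
rewrite /= belast_rcons last_rcons rcons_path /= => /andP[/andP[-> /e_rank ->] /eqP<-].
by rewrite addnS /= eqxx.
Qed.

End SymChain.

Definition pair_cover (T U : eqType) (e1 : rel T) (e2 : rel U) : rel (T * U) :=
  fun z z' => (z.1 == z'.1) && e2 z.2 z'.2 || e1 z.1 z'.1 && (z.2 == z'.2).

Definition pair_rank (T U : Type) (r1 : T -> nat) (r2 : U -> nat) (z : T * U) :=
  r1 z.1 + r2 z.2.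

Section Hook.
Variables (T U : eqType) (e1 : rel T) (e2 : rel U) (r1 : T -> nat) (r2 : U -> nat).

Lemma path_pairl d c C :
  path e1 c C -> path (pair_cover e1 e2) (c, d) [seq (x, d) | x <- C].
Proof.
apply: (@homo_path _ _ (fun x => (x, d))) => x y e.
by rewrite /pair_cover /= e eqxx orbT.
Qed.

Lemma path_pairr c d D :
  path e2 d D -> path (pair_cover e1 e2) (c, d) [seq (c, y) | y <- D].
Proof.
apply: (@homo_path _ _ (pair c)) => x y e.
by rewrite /pair_cover /= e eqxx.
Qed.

Lemma sym_hook N M C D : sym_chain e1 r1 N C -> sym_chain e2 r2 M D ->
  sym_chain (pair_cover e1 e2) (pair_rank r1 r2) (N + M) (hook C D).
Proof.
case: C D => [|c C] [|d D] //= /andP[pC /eqP<-] /andP[pD /eqP<-].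
rewrite cat_path last_cat (last_map (fun x => (x, d))) path_pairl //=.
rewrite (last_map (pair (last c C))) path_pairr // /pair_rank /=.
by rewrite addnACA eqxx.
Qed.

End Hook.

Lemma sym_chain_swap (T U : eqType) (e1 : rel T) (e2 : rel U) r1 r2 N s :
  sym_chain (pair_cover e1 e2) (pair_rank r1 r2) N (map (@swap U T) s) =
  sym_chain (pair_cover e2 e1) (pair_rank r2 r1) N s.
Proof.
case: s => //= z s; rewrite last_map /pair_rank /= ![r2 _ + _]addnC.
congr (_ && _); apply: mono_path => x y; rewrite /pair_cover /= orbC.
by congr (_ || _); rewrite andbC.
Qed.

(** Dropping the last element of one chain lowers its rank sum by one, and dropping the first
    element of the other raises it by one, so all hooks have rank sum [N + M]. *)
Lemma sym_hooks (T U : eqType) (e1 : rel T) (e2 : rel U) r1 r2 w N M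
    (C : seq T) (D : seq U) :
  (forall x y, e1 x y -> r1 y = (r1 x).+1) ->
  (forall x y, e2 x y -> r2 y = (r2 x).+1) ->
  grid_spec w C D -> sym_chain e1 r1 N C -> sym_chain e2 r2 M D ->
  all (sym_chain (pair_cover e1 e2) (pair_rank r1 r2) (N + M)) (hooks w C D).
Proof.
move=> rk1 rk2; elim: w N M C D => [|b w IH] N M C D spec sC sD.
  by rewrite /= sym_hook.
have [C1 D1] : 1 < size C /\ 1 < size D by case/and3P: spec => /=; lia.
case: b spec => [/grid_spec_true|/grid_spec_false] spec /=.
  rewrite sym_hook //=; case: (sym_chain_but_last rk1 C1 sC) => N0 sC'.
  by rewrite -(prednK N0) addSnnS IH // sym_chain_behead.
rewrite sym_chain_swap addnC sym_hook //=.
case: (sym_chain_but_last rk2 D1 sD) => M0 sD'.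
by rewrite -(prednK M0) addSnnS addnC IH // sym_chain_behead.
Qed.

Lemma starts_twiceE w : starts_twice w -> exists b w', w = [:: b, b & w'].
Proof. by case: w => [|b [|b' w]] //= /eqP<-; exists b, w. Qed.

Section Grid.
Variables (T U : eqType) (e1 : rel T) (e2 : rel U) (r1 : T -> nat) (r2 : U -> nat).
Hypothesis e1_rank : forall x y, e1 x y -> r1 y = (r1 x).+1.
Hypothesis e2_rank : forall x y, e2 x y -> r2 y = (r2 x).+1.

Lemma perm_grid w (C : seq T) (D : seq U) : grid_spec w C D ->
  perm_eq (flatten (grid w C D)) [seq (x, y) | x <- C, y <- D].
Proof.
move=> spec; rewrite /grid; case: ifP => [tw|_]; last exact: perm_hooks.
apply: perm_trans (perm_hooks spec); apply: perm_swap_ends.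
have [b [w' Ew]] := starts_twiceE tw.
move: spec; rewrite /grid_spec Ew => /and3P[C0 D0 /= /eqP l].
by case: b {Ew} => /=; rewrite ?size_map size_hook //; lia.
Qed.

(** The first new chain keeps the end points of the first hook, and the second is that hook without
    its two ends; the rank sum is the same for both. *)
Lemma sym_swap_ends (A : eqType) (e : rel A) r N (x y : A) K L H :
  (forall x y, e x y -> r y = (r x).+1) ->
  1 < size K -> e x y -> e (last y L) (last x K) ->
  all (sym_chain e r N) [:: x :: K, y :: L & H] ->
  all (sym_chain e r N) (swap_ends [:: x :: K, y :: L & H]).
Proof.
move=> rk sK exy eL /and3P[sxK /andP[pL _] aH].
apply/and3P; split; last exact: aH.
  case/andP: sxK => _; rewrite /= last_rcons => ->.
  by rewrite rcons_path exy pL eL.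
have sxK' : 1 < size (x :: K) by apply: ltnW.
by case: (sym_chain_but_last rk sK (sym_chain_behead rk sxK' sxK)).
Qed.

Lemma sym_grid_true w N M (C : seq T) (D : seq U) :
  grid_spec [:: true, true & w] C D -> sym_chain e1 r1 N C -> sym_chain e2 r2 M D ->
  all (sym_chain (pair_cover e1 e2) (pair_rank r1 r2) (N + M))
      (grid [:: true, true & w] C D).
Proof.
move=> spec sC sD; have := sym_hooks e1_rank e2_rank spec sC sD.
have [C1 D1] : 2 < size C /\ 2 < size D by case/and3P: spec => /=; lia.
case: D {spec} D1 sD => [|d [|d' [|d2 D]]] // _ sD.
case: C C1 sC => // c C; case/lastP: C => [|C c'] //.
case/lastP: C => [|C c2] // _ sC.
(* The starts of the two hooks differ by the first step of [D], their ends by the last step of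
   [C]. *)
rewrite /grid /= !belast_rcons last_rcons /= last_rcons.
apply: sym_swap_ends.
- move=> x y /orP[/andP[/eqP xy /e2_rank]|/andP[/e1_rank xy /eqP]];
  by rewrite /pair_rank xy => ->; rewrite ?addnS.
- by rewrite size_cat size_map size_rcons /=; lia.
- by case/andP: sD => /= /andP[e _] _; rewrite /pair_cover /= eqxx e.
- rewrite !last_cat /= !last_map /pair_cover /= eqxx andbT; apply/orP; right.
  by case/andP: sC; rewrite rcons_path last_rcons => /andP[].
Qed.
End Grid.

Lemma map_negbK w : map negb (map negb w) = w.
Proof. by rewrite -map_comp map_id_in // => b _ /=; rewrite negbK. Qed.

Lemma sym_grid (T U : eqType) (e1 : rel T) (e2 : rel U) r1 r2 w N M
    (C : seq T) (D : seq U) :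
  (forall x y, e1 x y -> r1 y = (r1 x).+1) ->
  (forall x y, e2 x y -> r2 y = (r2 x).+1) ->
  grid_spec w C D -> sym_chain e1 r1 N C -> sym_chain e2 r2 M D ->
  all (sym_chain (pair_cover e1 e2) (pair_rank r1 r2) (N + M)) (grid w C D).
Proof.
move=> rk1 rk2 spec sC sD.
case tw: (starts_twice w); last by rewrite /grid tw sym_hooks.
have [[] [w' Ew]] := starts_twiceE tw; first by rewrite Ew in spec *; apply: sym_grid_true.
rewrite -(map_negbK w) grid_swap ?grid_spec_swap // all_map.
have := grid_spec_swap spec; rewrite Ew /= => spec'.
rewrite (eq_all (sym_chain_swap _ _ _ _ _)) addnC.
exact: sym_grid_true.
Qed.

(** * Small chains of a grid *)

Lemma nth_but_last (T : Type) (x0 : T) s i : i.+1 < size s -> nth x0 (but_last s) i = nth x0 s i.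
Proof.
case/lastP: s => // s x; rewrite but_last_rcons size_rcons ltnS nth_rcons => ->.
by [].
Qed.

(* The end points of the last hook of [hooks w C D]. *)
Definition innermost (T U : Type) (x0 : T) (y0 : U) w (C : seq T) (D : seq U) :=
  ((nth x0 C (count negb w), nth y0 D (count id w)),
   (nth x0 C ((size C).-1 - count id w), nth y0 D ((size D).-1 - count negb w))).

(** Both sides have at least two elements when a letter is read, so a peeled hook has at least
    three. A small hook is therefore the last one, whose size is one more than the difference of the
    side lengths. *)
Lemma hooks_small (T U : eqType) (x0 : T) (y0 : U) w C D K :
  grid_spec w C D -> K \in hooks w C D -> size K <= 2 ->
  [/\ size C <= (size D).+1, size D <= (size C).+1,
      (innermost x0 y0 w C D).1 \in K & (innermost x0 y0 w C D).2 \in K].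
Proof.
rewrite /innermost; elim: w C D => [|b w IH] C D spec.
  rewrite inE => /eqP-> {K}; case/and3P: spec => C0 D0 /eqP l; rewrite size_hook // => sK.
  split; try lia; rewrite ?subn0.
    by case: C C0 D D0 {l sK} => // c C _ [|d D] //= _; rewrite inE eqxx.
  case: C C0 D D0 {l sK} => // c C _ [|d D] // _.
  rewrite !nth_last /= -cat_cons mem_cat; case/lastP: D => [|D d'] /=.
    by rewrite (map_f (fun x => (x, d)) (mem_last c C)).
  by rewrite last_rcons (map_f (pair (last c C))) ?orbT // mem_rcons mem_head.
have [C1 D1] : 1 < size C /\ 1 < size D by case/and3P: spec => /=; lia.
case: b spec => spec /=; rewrite inE => /orP[/eqP->|].
- by rewrite size_hook //; lia.
- move=> /(IH _ _ (grid_spec_true spec)) H /H {H}; case/and3P: spec => _ _ /= /eqP l.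
  have := count_size id w; have := count_size negb w => n1 n2.
  rewrite size_but_last size_behead !nth_behead !nth_but_last ?add0n ?add1n; try lia.
  case=> sC sD m1 m2; split; [lia|lia|by []|move: m2].
  have -> : (size C).-1 - (count id w).+1 = (size C).-1.-1 - count id w by lia.
  by have -> : (size D).-1 - count negb w = ((size D).-1.-1 - count negb w).+1 by lia.
- by rewrite size_map size_hook //; lia.
- move=> /(IH _ _ (grid_spec_false spec)) H /H {H}; case/and3P: spec => _ _ /= /eqP l.
  have := count_size id w; have := count_size negb w => n1 n2.
  rewrite size_but_last size_behead !nth_behead !nth_but_last ?add0n ?add1n; try lia.
  case=> sC sD m1 m2; split; [lia|lia|by []|move: m2].
  have -> : (size D).-1 - (count negb w).+1 = (size D).-1.-1 - count negb w by lia.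
  by have -> : (size C).-1 - count id w = ((size C).-1.-1 - count id w).+1 by lia.
Qed.

(** The exchange of ends creates no small chain: it needs sides of at least three elements, and then
    the first two hooks have at least five and three elements. *)
Lemma grid_small (T U : eqType) (x0 : T) (y0 : U) w C D K :
  grid_spec w C D -> K \in grid w C D -> size K <= 2 ->
  [/\ size C <= (size D).+1, size D <= (size C).+1,
      (innermost x0 y0 w C D).1 \in K & (innermost x0 y0 w C D).2 \in K].
Proof.
move=> spec; rewrite /grid; case: ifP => tw; last exact: hooks_small.
move=> KG sK; apply: hooks_small => //; move: KG sK.
have [b [w' Ew]] := starts_twiceE tw.
have [C2 D2] : 2 < size C /\ 2 < size D.
  by move: spec; rewrite Ew => /and3P[] /=; lia.
have sz : exists H1 H2 H, [/\ hooks w C D = [:: H1, H2 & H], 4 < size H1 & 2 < size H2].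
  rewrite Ew; case: b {Ew}; do 3!eexists; (split; first by []);
    rewrite ?size_map size_hook ?size_but_last ?size_behead; lia.
case: sz => H1 [H2 [H [-> sH1 sH2]]].
case: H1 sH1 => [|x H1] //= sH1; rewrite !inE => /or3P[/eqP->|/eqP->|->]; last by rewrite !orbT.
  by rewrite /= size_rcons; lia.
by rewrite size_but_last; lia.
Qed.

(** * Full lines of a grid *)

Lemma hooks_sub (T U : eqType) w (C : seq T) (D : seq U) K x y :
  grid_spec w C D -> K \in hooks w C D -> (x, y) \in K -> (x \in C) && (y \in D).
Proof.
move=> /perm_hooks/perm_mem/(_ (x, y)) E KH xyK.
have : (x, y) \in flatten (hooks w C D) by apply/flattenP; exists K.
by rewrite E => /allpairsP[[a b] [/= ? ? [-> ->]]]; apply/andP.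
Qed.

Lemma mem_but_last (T : eqType) (s : seq T) : {subset but_last s <= s}.
Proof. by case/lastP: s => // s x y; rewrite but_last_rcons mem_rcons inE orbC => ->. Qed.

Lemma mem_hook (T U : eqType) c (C : seq T) d (D : seq U) x y :
  ((x, y) \in hook (c :: C) (d :: D)) =
  (x \in c :: C) && (y == d) || (x == last c C) && (y \in D).
Proof.
rewrite mem_cat; congr (_ || _); apply/mapP/andP.
- by case=> z zC [-> ->].
- by case=> xC /eqP->; exists x.
- by case=> z zC [-> ->].
- by case=> /eqP-> yD; exists y.
Qed.

Definition hook_inner (T U : Type) (C : seq T) c' d (D : seq U) :=
  [seq (x, d) | x <- rcons C c'] ++ [seq (c', y) | y <- D].

Lemma hook_rcons (T U : Type) c (C : seq T) c' d (D : seq U) d' :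
  hook (c :: rcons C c') (d :: rcons D d') =
  (c, d) :: rcons (hook_inner C c' d D) (c', d').
Proof. by rewrite /= last_rcons [map _ (rcons D d')]map_rcons -rcons_cat. Qed.

Lemma uniq_ends (A : eqType) (x : A) s y : uniq (x :: rcons s y) ->
  [/\ x == y = false, (x \in rcons s y) = false & (y \in x :: s) = false].
Proof.
rewrite /= rcons_uniq mem_rcons !inE negb_or => /and3P[/andP[xy xs] ys _].
by rewrite (negbTE xy) (negbTE xs) eq_sym (negbTE xy) (negbTE ys).
Qed.

(** After the exchange the first chain has [(c, d)] as its only pair with [d] and [(c', d')] as its
    only pair with [c'], and it lacks [(c, d')]. The second chain has no pair with [c] or [d'], and
    the later hooks have none with [c'] or [d]. *)
Lemma grid_true_no_line (T U : eqType) w c (C : seq T) c' d (D : seq U) d' K :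
  uniq (c :: rcons C c') -> uniq (d :: rcons D d') -> 0 < size C -> 0 < size D ->
  grid_spec [:: true, true & w] (c :: rcons C c') (d :: rcons D d') ->
  K \in grid [:: true, true & w] (c :: rcons C c') (d :: rcons D d') ->
  (forall x, (x, d) \in K -> (x, d') \notin K) /\
  (forall y, (c, y) \in K -> (c', y) \notin K).
Proof.
move=> uC uD; case: C uC => // c1 C uC _; case: D uD => // d1 D uD _ spec.
have spec2 := grid_spec_true (grid_spec_true spec).
rewrite -(rcons_cons c) but_last_rcons in spec2.
have [cc' cC c'C] := uniq_ends uC; have [dd' dD d'D] := uniq_ends uD.
have [d1d' _ _] : [/\ d1 == d' = false, (d1 \in rcons D d') = false & (d' \in d1 :: D) = false].
  by apply: uniq_ends; case/andP: uD.
have /norP[/negbTE dd1 /negbTE dD'] : ~~ ((d == d1) || (d \in rcons D d')).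
  by have := dD; rewrite inE => ->.
have cl : c == last c1 C = false.
  by apply: contraFF cC => /eqP->; rewrite mem_rcons inE mem_last orbT.
have c'l : c' == last c1 C = false.
  by apply: contraFF c'C => /eqP->; rewrite inE mem_last orbT.
rewrite [grid _ _ _]/(swap_ends [:: hook _ _, hook _ _ & hooks w _ _]).
rewrite hook_rcons last_rcons but_last_rcons -!(rcons_cons c) !but_last_rcons /behead.
rewrite -[rcons (d1 :: D) d']/(d1 :: rcons D d').
rewrite !inE => /or3P[/eqP->|/eqP->|KH]; split=> z.
- rewrite in_cons mem_rcons in_cons !xpair_eqE mem_hook dd' dd1 dD' !andbF eqxx andbT !orbF.
  move=> /eqP-> {z}; rewrite in_cons mem_rcons in_cons !xpair_eqE mem_hook eqxx cc'.
  by rewrite (eq_sym d') dd' (eq_sym d') d1d' cl !andbF.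
- move=> cz; apply/negP; rewrite in_cons mem_rcons in_cons !xpair_eqE mem_hook.
  rewrite (eq_sym c') cc' c'C c'l eqxx !andFb !orbF orFb => /eqP zd'; move: cz.
  rewrite zd' in_cons mem_rcons in_cons !xpair_eqE mem_hook cc' cl.
  by rewrite (eq_sym d') dd' (eq_sym d') d1d' !andbF.
- move=> _; rewrite mem_cat; apply/norP; split; apply/mapP=> -[x xin [_ d'z]].
    by rewrite d'z eqxx in dd'.
  by move: d'D; rewrite d'z inE xin orbT.
- rewrite mem_cat => /orP[]/mapP[x xin [cx _]].
    by rewrite cx xin in cC.
  by rewrite cx eqxx in cc'.
- by move=> /(hooks_sub spec2 KH) /andP[_] /=; rewrite dD'.
- move=> _; apply/negP => /(hooks_sub spec2 KH) /andP[/mem_but_last].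
  by rewrite c'C.
Qed.

Lemma hook_sub (T U : eqType) (C : seq T) (D : seq U) x y :
  (x, y) \in hook C D -> (x \in C) && (y \in D).
Proof.
case: C D => [|c C] [|d D] //; rewrite mem_hook => /orP[/andP[-> /eqP->]|/andP[/eqP-> yD]].
  by rewrite mem_head.
by rewrite mem_last inE yD orbT.
Qed.

(** Only grids in which [C] has one or two elements keep a line in the direction of [D]. With two,
    the single letter decides where: [true] gives the column over the last element of [C], [false]
    the one over the first. *)
Lemma grid_line (T U : eqType) w c (C : seq T) d (D : seq U) K x :
  uniq (c :: C) -> uniq (d :: D) -> 2 < size D ->
  grid_spec w (c :: C) (d :: D) -> starts_twice w || (size w <= 1) ->
  K \in grid w (c :: C) (d :: D) -> (x, d) \in K -> (x, last d D) \in K ->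
  C = [::] \/ exists2 c', C = [:: c'] & x = if w == [:: true] then c' else c.
Proof.
move=> uC uD sD spec; case/orP=> [tw|w1] KG xd xd'.
  have [b [w' Ew]] := starts_twiceE tw.
  have sC : 1 < size C by case/and3P: spec => _ _; rewrite Ew /=; lia.
  case/lastP: C uC sC spec KG => // C c' uC; rewrite size_rcons ltnS => C0.
  case/lastP: D uD sD xd xd' => // D d' uD; rewrite size_rcons last_rcons => sD xd xd'.
  have {}sD : 0 < size D by lia.
  rewrite Ew; case: b {Ew} => spec KG.
    by have [/(_ _ xd)] := grid_true_no_line uC uD C0 sD spec KG; rewrite xd'.
  have := grid_swap (grid_spec_swap spec); rewrite map_negbK => E.
  move: KG xd xd'; rewrite E => /mapP[K' KG ->]; rewrite !mem_map_swap => xd xd'.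
  have [_ /(_ _ xd)] := grid_true_no_line uD uC sD C0 (grid_spec_swap spec) KG.
  by rewrite xd'.
case: C uC spec KG => [|c' C] uC spec KG; first by left.
right; have [b Ew] : exists b, w = [:: b].
  case/and3P: spec => _ _; case: w w1 {KG} => [|b [|]] //=; last by exists b.
  by move=> _; lia.
have C0 : C = [::] by case: C {uC KG} spec => // z C; rewrite Ew => /and3P[_ _ /=]; lia.
exists c'; first by rewrite C0.
move: KG xd xd' uC; rewrite C0 Ew /grid => KG xd xd' /andP[]; rewrite inE => /negbTE cc' _.
case/lastP: D uD sD {spec} KG xd xd' => // D d' uD _.
have [dd' dD d'D] := uniq_ends uD; rewrite last_rcons.
have d'd : d' == d = false by rewrite eq_sym.
case: b {Ew} => KG.
  have : K \in [:: hook [:: c; c'] (d :: rcons D d'); hook [:: c] (rcons D d')] := KG.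
  rewrite !inE => /orP[]/eqP->; last by move=> /hook_sub; rewrite dD andbF.
  by rewrite !mem_hook d'd andbF => _ /andP[/eqP].
have : K \in [:: map (@swap U T) (hook (d :: rcons D d') [:: c; c']);
                 hook [:: c'] (but_last (d :: rcons D d'))] := KG.
rewrite -rcons_cons but_last_rcons !inE => /orP[]/eqP->.
  rewrite !mem_map_swap !mem_hook last_rcons dd' andFb orbF.
  by move=> /andP[_ /eqP].
by move=> _ /hook_sub; rewrite d'D andbF.
Qed.

Lemma grid_sub (T U : eqType) w (C : seq T) (D : seq U) L x y :
  grid_spec w C D -> L \in grid w C D -> (x, y) \in L -> x \in C /\ y \in D.
Proof.
move=> /perm_grid/perm_mem/(_ (x, y)) E LG xyL.
have : (x, y) \in flatten (grid w C D) by apply/flattenP; exists L.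
by rewrite E => /allpairsP[[a b] [/= aC bD [-> ->]]].
Qed.

(** * Products of families *)

(** Bit sequences are characteristic vectors. [all2 implb] is inclusion and also forces equal
    lengths, so this is the covering relation of the cube. *)
Definition covers (u v : bitseq) : bool :=
  all2 implb u v && (count id v == (count id u).+1).

Notation cube_chain := (sym_chain covers (count id)).

Definition cube_scd n (D : seq (seq bitseq)) : Prop :=
  [/\ all (cube_chain n) D, uniq (flatten D) & forall u, (u \in flatten D) = (size u == n)].

Definition pole (u : bitseq) : bool := (count id u == 0) || (count id u == size u).

(** Exchanging [x] and [y] shows that both common elements are poles. This is almost-orthogonality
    without reference to chain sizes. *)
Definition cube_family k n (F : 'I_k -> seq (seq bitseq)) : Prop :=
  (forall i, cube_scd n (F i)) /\
  (forall i j s t x y, i != j -> s \in F i -> t \in F j ->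
     x \in s -> x \in t -> y \in s -> y \in t -> x != y -> pole x).

Definition colors_small k (own : bitseq -> nat) (F : 'I_k -> seq (seq bitseq)) : Prop :=
  forall i s, s \in F i -> size s <= 2 -> has (fun x => own x == i) s.

(** The letters are ordered so that, whatever [a] is, a word of at least three letters starts with
    two equal ones. *)
Definition turn_word a l :=
  if 1 < a then nseq a true ++ nseq (l - a) false else nseq (l - a) false ++ nseq a true.

Definition hook_count (T U : Type) (C : seq T) (D : seq U) := (minn (size C) (size D)).-1.

Definition nearly_square (T U : Type) (C : seq T) (D : seq U) :=
  (size C <= (size D).+1) && (size D <= (size C).+1).

Definition owned_turn (own : bitseq -> nat) (i : nat) (C D : seq bitseq) a :=
  let: (z, z') := innermost [::] [::] (turn_word a (hook_count C D)) C D in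
  (own (z.1 ++ z.2) == i) || (own (z'.1 ++ z'.2) == i).

(* The number of letters [true] used for the product of C and D. In a grid that
   is nearly a square the last hook is a small chain of the product and has to
   meet colour i; in a grid of width 2 one line stays full, and it has to be the
   line over the element of colour i. *)
Definition turns (own1 own2 own : bitseq -> nat) (i : nat) (C D : seq bitseq) : nat :=
  let l := hook_count C D in
  (* [find] returns [l.+1] if no number of turns works; [minn] keeps the word within its length. *)
  if nearly_square C D then minn l (find (owned_turn own i C D) (iota 0 l.+1))
  else if size D == 2 then nat_of_bool (own2 (head [::] D) == i)
  else if size C == 2 then nat_of_bool (own1 (last [::] C) == i)
  else l.

Definition cat_pair (z : bitseq * bitseq) : bitseq := z.1 ++ z.2.

Definition prod_chains own1 own2 own i (C D : seq bitseq) : seq (seq bitseq) :=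
  map (map cat_pair) (grid (turn_word (turns own1 own2 own i C D) (hook_count C D)) C D).

Definition prod_family k own1 own2 own (F G : 'I_k -> seq (seq bitseq)) (i : 'I_k) :=
  flatten [seq prod_chains own1 own2 own i C D | C <- F i, D <- G i].

Lemma size_turn_word a l : a <= l -> size (turn_word a l) = l.
Proof. by rewrite /turn_word => al; case: ifP; rewrite size_cat !size_nseq; lia. Qed.

Lemma count_turn_word a l : count id (turn_word a l) = a.
Proof. by rewrite /turn_word; case: ifP => _; rewrite count_cat !count_nseq /=; lia. Qed.

Lemma countC_turn_word a l : count negb (turn_word a l) = l - a.
Proof. by rewrite /turn_word; case: ifP => _; rewrite count_cat !count_nseq /=; lia. Qed.

Lemma starts_twice_turn_word a l : a <= l -> 2 < l -> starts_twice (turn_word a l).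
Proof.
move=> al l2; rewrite /turn_word; case: ifP; first by case: a al => [|[|a]].
move=> a1; have : 1 < l - a by lia.
by case: (l - a) => [|[|b]].
Qed.

Lemma turns_leq own1 own2 own i C D : 0 < size C -> 0 < size D ->
  turns own1 own2 own i C D <= hook_count C D.
Proof.
rewrite /turns /nearly_square /hook_count => C0 D0; case: ifP => [_|nc]; first by rewrite geq_minl.
case: ifP => [/eqP D2|_]; first by case: (_ == _) => //=; lia.
case: ifP => [/eqP C2|_] //; by case: (_ == _) => //=; lia.
Qed.

Lemma prod_grid_spec own1 own2 own i (C D : seq bitseq) : 0 < size C -> 0 < size D ->
  grid_spec (turn_word (turns own1 own2 own i C D) (hook_count C D)) C D.
Proof.
by move=> C0 D0; rewrite /grid_spec C0 D0 size_turn_word ?turns_leq //= eqxx.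
Qed.

Lemma perm_flatten_allpairs (A B R : eqType) (f : A -> B -> R) g S1 S2 :
  {in S1 & S2, forall C D, perm_eq (flatten (g C D)) [seq f x y | x <- C, y <- D]} ->
  perm_eq (flatten (flatten [seq g C D | C <- S1, D <- S2]))
          [seq f x y | x <- flatten S1, y <- flatten S2].
Proof.
elim: S1 => [|C S1 IH] //= gP; rewrite allpairs_cat !flatten_cat.
apply: perm_cat; last by apply: IH => E D ES; apply: gP; rewrite inE ES orbT.
have {gP} : {in S2, forall D, perm_eq (flatten (g C D)) [seq f x y | x <- C, y <- D]}.
  by move=> D; apply: gP; rewrite mem_head.
elim: S2 {IH} => [|D S2 IH] gP /=; first by elim: C {gP}.
rewrite flatten_cat perm_sym perm_allpairs_catr perm_sym.
apply: perm_cat; first by apply: gP; rewrite mem_head.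
by apply: IH => E ES; apply: gP; rewrite inE ES orbT.
Qed.

Lemma sym_chain_map (A B : Type) (e : rel A) (e' : rel B) r r' (f : A -> B) N s :
  (forall x y, e x y -> e' (f x) (f y)) -> (forall x, r' (f x) = r x) ->
  sym_chain e r N s -> sym_chain e' r' N (map f s).
Proof.
move=> ef rf; case: s => //= x s /andP[p /eqP<-].
by rewrite last_map !rf eqxx andbT; apply: homo_path p.
Qed.

Lemma all2_implb_refl u : all2 implb u u.
Proof. by elim: u => //= -[]. Qed.

Lemma covers_rank u v : covers u v -> count id v = (count id u).+1.
Proof. by case/andP=> _ /eqP. Qed.

Lemma all2_implb_cat u u' v v' : all2 implb u u' -> all2 implb v v' ->
  all2 implb (u ++ v) (u' ++ v').
Proof. by elim: u u' => [|b u IH] [|b' u'] //= /andP[-> /IH]; apply. Qed.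

Lemma covers_cat_pair z z' : pair_cover covers covers z z' ->
  covers (cat_pair z) (cat_pair z').
Proof.
case: z z' => [u v] [u' v']; rewrite /pair_cover /covers /cat_pair /= !count_cat.
case/orP=> [/andP[/eqP<- /andP[vv' /eqP->]]|/andP[/andP[uu' /eqP->] /eqP<-]].
  by rewrite all2_implb_cat ?all2_implb_refl // addnS eqxx.
by rewrite all2_implb_cat ?all2_implb_refl // addSn eqxx.
Qed.

Lemma sym_chain_size (A : Type) (e : rel A) r N s : sym_chain e r N s -> 0 < size s.
Proof. by case: s. Qed.

Lemma cube_scd_mem n D s u : cube_scd n D -> s \in D -> u \in s -> size u = n.
Proof. by case=> _ _ H sD us; apply/eqP; rewrite -H; apply/flattenP; exists s. Qed.

Lemma cat_inj (A : Type) (u u' v v' : seq A) : size u = size u' -> u ++ v = u' ++ v' ->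
  u = u' /\ v = v'.
Proof.
by elim: u u' => [|a u IH] [|a' u'] //= [] /IH H [-> /H[-> ->]].
Qed.

(** A concatenation determines its two parts because all first parts have length [m]; so the
    products of chains tile the larger cube. *)
Lemma prod_scd k own1 own2 own m n (F G : 'I_k -> seq (seq bitseq)) i :
  cube_scd m (F i) -> cube_scd n (G i) ->
  cube_scd (m + n) (prod_family own1 own2 own F G i).
Proof.
move=> sF sG; have [aF uF mF] := sF; have [aG uG mG] := sG.
have spec C D : C \in F i -> D \in G i ->
    grid_spec (turn_word (turns own1 own2 own i C D) (hook_count C D)) C D.
  by move=> /(allP aF)/sym_chain_size C0 /(allP aG)/sym_chain_size D0; apply: prod_grid_spec.
have perm : perm_eq (flatten (prod_family own1 own2 own F G i))
   [seq x ++ y | x <- flatten (F i), y <- flatten (G i)].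
  apply: perm_flatten_allpairs => C D CF DG; rewrite -map_flatten.
  rewrite -(map_allpairs cat_pair pair); apply: perm_map.
  exact/perm_grid/spec.
split.
- apply/allP => K /flattenP[? /allpairsP[[C D] [/= CF DG ->]] /mapP[L LG ->]].
  apply: sym_chain_map (allP (sym_grid covers_rank covers_rank (spec _ _ CF DG)
    (allP aF _ CF) (allP aG _ DG)) _ LG); first exact: covers_cat_pair.
  by case=> u v; rewrite /cat_pair /pair_rank /= count_cat.
- rewrite (perm_uniq perm); apply: allpairs_uniq => // -[u v] [u' v'].
  move=> /allpairsP[[a b] [/= aF' bG [-> ->]]] /allpairsP[[a' b'] [/= aF'' bG' [-> ->]]].
  move: aF' aF''; rewrite !mF => /eqP sa /eqP sa' /cat_inj[|-> -> //].
  by rewrite sa sa'.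
- move=> u; rewrite (perm_mem perm); apply/allpairsP/eqP.
    by case=> -[a b] [/=]; rewrite mF mG => /eqP<- /eqP<- ->; rewrite size_cat.
  move=> su; exists (take m u, drop m u) => /=; rewrite cat_take_drop mF mG.
  by rewrite size_drop size_takel su ?leq_addr // addKn !eqxx.
Qed.

(** * Ranks and poles along a chain *)

Lemma path_ranks (A : Type) (e : rel A) (r : A -> nat) x s :
  (forall x y, e x y -> r y = (r x).+1) -> path e x s ->
  map r (x :: s) = iota (r x) (size s).+1.
Proof.
move=> rk; elim: s x => //= y s IH x /andP[/rk ry /IH /= ->].
by rewrite ry.
Qed.

Lemma last_rank (A : Type) (e : rel A) (r : A -> nat) x s :
  (forall x y, e x y -> r y = (r x).+1) -> path e x s ->
  r (last x s) = r x + size s.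
Proof.
move=> rk /(path_ranks rk) E; rewrite -last_map.
have -> : last (r x) (map r s) = last 0 (map r (x :: s)) by [].
by rewrite E -[_.+1]addn1 iotaD last_cat /= addnC addnC.
Qed.

Lemma uniq_map_inj (A B : eqType) (f : A -> B) s :
  uniq (map f s) -> {in s &, injective f}.
Proof.
move=> us x y /(nthP x)[a sa <-] /(nthP x)[b sb <-] E.
apply/eqP; rewrite nth_uniq ?(map_uniq us) //.
by rewrite -(nth_uniq (f x) _ _ us) ?size_map // !(nth_map x) // E.
Qed.

Lemma chain_uniq_ranks n s : cube_chain n s -> uniq (map (count id) s).
Proof.
case: s => // x s /andP[/(path_ranks covers_rank) -> _]; exact: iota_uniq.
Qed.

Lemma chain_rank_inj n s : cube_chain n s -> {in s &, injective (count id)}.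
Proof. by move=> /chain_uniq_ranks/uniq_map_inj. Qed.

Lemma chain_uniq n s : cube_chain n s -> uniq s.
Proof. by move=> /chain_uniq_ranks/map_uniq. Qed.

Lemma all2_implb_trans : transitive (all2 implb).
Proof.
elim=> [|b v IH] [|a u] [|c w] //= /andP[ab uv] /andP[bc vw].
by rewrite (IH _ _ uv vw) andbT; case: a b c ab bc => [] [] [].
Qed.

Lemma all2_implb_count u v : all2 implb u v -> count id u <= count id v.
Proof. by elim: u v => [|a u IH] [|b v] //= /andP[ab /IH]; case: a b ab => [] []; lia. Qed.

Lemma chain_comparable n s x y : cube_chain n s -> x \in s -> y \in s ->
  all2 implb x y || all2 implb y x.
Proof.
case: s => // a s /andP[p _] xs ys.
have {p} /(pairwiseP [::]) H : pairwise (all2 implb) (a :: s).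
  rewrite -(sorted_pairwise all2_implb_trans) /=.
  by apply: sub_path p => u v /andP[].
move/(nthP [::]): xs ys => [i si <-] /(nthP [::])[j sj <-].
have [ij|ji|->] := ltngtP i j; last by rewrite all2_implb_refl.
  by rewrite H.
by rewrite (H j i) ?orbT.
Qed.

(** Elements of a chain are determined by their ranks, so two distinct poles have ranks [0] and [m],
    and the chain runs through all ranks. *)
Lemma pole_ends (m : nat) c C x y : cube_chain m (c :: C) -> {in c :: C, forall u, size u = m} ->
  x \in c :: C -> y \in c :: C -> x != y -> pole x -> pole y ->
  [/\ size C = m, count id c = 0, count id (last c C) = m &
      (x = c /\ y = last c C) \/ (x = last c C /\ y = c)].
Proof.
move=> ch sz xC yC xy px py; have inj := chain_rank_inj ch.
have [p /eqP N] := andP ch.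
have lC := last_rank covers_rank p.
have lo u : u \in c :: C -> count id c <= count id u <= count id c + size C.
  move=> /(map_f (count id)); rewrite (path_ranks covers_rank p) mem_iota; lia.
have cc : c \in c :: C by rewrite mem_head.
have ll : last c C \in c :: C by rewrite mem_last.
have ne u v : u \in c :: C -> v \in c :: C -> count id u = count id v -> u = v by apply: inj.
have := lo _ xC; have := lo _ yC.
have ckxy : count id x != count id y by apply: contra xy => /eqP/inj->.
move: px py ckxy; rewrite /pole !sz // => px py ckxy rx ry.
rewrite lC in N.
have [c0 sC] : count id c = 0 /\ size C = m.
  by case/orP: px => /eqP px; case/orP: py => /eqP py; move/eqP: ckxy; lia.
split=> //; first by lia.
case/orP: px => /eqP px; case/orP: py => /eqP py; move/eqP: ckxy => ckxy.
- lia.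
- by left; split; apply: ne => //; lia.
- by right; split; apply: ne => //; lia.
- lia.
Qed.

(** * Full lines of product chains and their colours *)

Section Lines.
Variables (own1 own2 own : bitseq -> nat) (i : nat).

(** Next to a side of more than four elements, every word falls under [grid_line]: it triggers the
    exchange of ends or has at most one letter. *)
Lemma turn_word_twice (C D : seq bitseq) : 0 < size C -> 0 < size D ->
  (4 < size C) || (4 < size D) ->
  let w := turn_word (turns own1 own2 own i C D) (hook_count C D) in
  starts_twice w || (size w <= 1).
Proof.
move=> C0 D0 big /=; have tl := turns_leq own1 own2 own i C0 D0.
rewrite size_turn_word //; case: (ltngtP (hook_count C D) 2) => [l1|l2|l2].
- by rewrite orbC -ltnS l1.
- by rewrite starts_twice_turn_word.
(* With two letters the sides have three and at least five elements, so only the last branch of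
   [turns] remains and the word is twice [true]. *)
rewrite /turns /nearly_square l2; move: l2; rewrite /hook_count => l2.
case: ifP => [|_]; first by lia.
case: ifP => [|_]; first by lia.
by case: ifP => [|_]; first by lia.
Qed.

(** By [grid_line], a full line over [x] leaves a [C] with one or two elements. A single element has
    colour [i] by hypothesis; of two, [turns] has put the line over a coloured one. *)
Lemma col_owned m n (C D : seq bitseq) L x d D' : 3 < n ->
  cube_chain m C -> (size C <= 2 -> has (fun u => own1 u == i) C) ->
  cube_chain n D -> D = d :: D' -> size D' = n ->
  L \in grid (turn_word (turns own1 own2 own i C D) (hook_count C D)) C D ->
  (x, d) \in L -> (x, last d D') \in L -> own1 x = i.
Proof.
move=> n3 chC small chD ED sD LG xd xd'.
have C0 := sym_chain_size chC; have D0 := sym_chain_size chD.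
have spec := prod_grid_spec own1 own2 own i C0 D0.
have tw : starts_twice (turn_word (turns own1 own2 own i C D) (hook_count C D)) ||
  (size (turn_word (turns own1 own2 own i C D) (hook_count C D)) <= 1).
  by apply: turn_word_twice => //; rewrite ED /= sD ltnS n3 orbT.
case: C chC small C0 spec tw LG => // c C chC small _ spec tw; rewrite ED => LG.
rewrite ED in spec tw chD.
have sD' : 2 < size D' by rewrite sD; apply: ltnW.
have [xC _] := grid_sub spec LG xd.
have := grid_line (chain_uniq chC) (chain_uniq chD) sD' spec tw LG xd xd'.
case=> [C0|[c' C1]].
  by move: small xC; rewrite C0 inE /= orbF => /(_ isT)/eqP oc /eqP->.
move: small; rewrite C1 {xC} /turns /nearly_square /hook_count /= eqSS => /(_ isT).
rewrite sD.
have -> : (n < 3) = false by lia.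
have -> : (n == 1) = false by lia.
rewrite /= orbF.
have -> : (minn 2 n.+1).-1 = 1 by lia.
(* If the last element of [C] does not have colour [i], the first one does, and the letter is
   [false]. *)
by case: (own1 c' =P i) => [? _ ->|_ /= /orP[/eqP|] // ? ->].
Qed.

(** The transposed form of [col_owned]. Transposition negates the letter, which is why [turns] tests
    the first element of [D] but the last element of [C]. *)
Lemma row_owned m n (C D : seq bitseq) L y c C' : 3 < m ->
  cube_chain n D -> (size D <= 2 -> has (fun u => own2 u == i) D) ->
  cube_chain m C -> C = c :: C' -> size C' = m ->
  L \in grid (turn_word (turns own1 own2 own i C D) (hook_count C D)) C D ->
  (c, y) \in L -> (last c C', y) \in L -> own2 y = i.
Proof.
move=> n3 chD small chC EC sC LG cy cy'.
have C0 := sym_chain_size chC; have D0 := sym_chain_size chD.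
have spec := prod_grid_spec own1 own2 own i C0 D0.
have tw : starts_twice (turn_word (turns own1 own2 own i C D) (hook_count C D)) ||
  (size (turn_word (turns own1 own2 own i C D) (hook_count C D)) <= 1).
  by apply: turn_word_twice => //; rewrite EC /= sC ltnS n3.
case: D chD small D0 spec tw LG => // d D chD small _ spec tw; rewrite EC => LG.
rewrite EC in spec tw chC.
have [_ yD] := grid_sub spec LG cy.
have sC' : 2 < size C' by rewrite sC; apply: ltnW.
have spec' := grid_spec_swap spec.
have LG' : map (@swap _ _) L \in grid (map negb (turn_word (turns own1 own2 own i (c :: C') (d :: D))
      (hook_count (c :: C') (d :: D)))) (d :: D) (c :: C').
  by rewrite grid_swap // map_f.
have := grid_line (x := y) (chain_uniq chD) (chain_uniq chC) sC' spec' _ LG'.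
rewrite starts_twice_negb size_map !mem_map_swap => /(_ tw cy cy').
case=> [D0|[d' D1]].
  by move: small yD; rewrite D0 inE /= orbF => /(_ isT)/eqP oc /eqP->.
move: small; rewrite D1 {yD} /turns /nearly_square /hook_count /= ?eqSS => /(_ isT).
rewrite sC.
have -> : (m < 3) = false by lia.
rewrite andFb /= orbF.
have -> : (minn m.+1 2).-1 = 1 by lia.
by case: (own2 d =P i) => [? _ ->|_ /= /eqP ? ->].
Qed.
End Lines.

Lemma all2_cat (A B : Type) (r : A -> B -> bool) s1 s2 t1 t2 : size s1 = size t1 ->
  all2 r (s1 ++ s2) (t1 ++ t2) = all2 r s1 t1 && all2 r s2 t2.
Proof. by elim: s1 t1 => [|x s1 IH] [|y t1] //= [/IH->]; rewrite andbA. Qed.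

(** * Almost-orthogonality and colours of a product *)

Section Product.
Variables (k : nat) (own1 own2 own : bitseq -> nat) (m n : nat).
Variables (F G : 'I_k -> seq (seq bitseq)).
Hypotheses (m3 : 3 < m) (n3 : 3 < n).
Hypotheses (famF : cube_family m F) (famG : cube_family n G).
Hypotheses (smallF : colors_small own1 F) (smallG : colors_small own2 G).

Let word i C D := turn_word (turns own1 own2 own i C D) (hook_count C D).

Lemma prod_mem i s x : s \in prod_family own1 own2 own F G i -> x \in s ->
  exists C D L u v, [/\ C \in F i, D \in G i, L \in grid (word i C D) C D,
    s = map cat_pair L & [/\ x = u ++ v, (u, v) \in L, u \in C & v \in D]].
Proof.
case/flattenP=> _ /allpairsP[[C D] [/= CF DG ->]] /mapP[L LG ->] /mapP[[u v] uvL ->].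
have [/(_ i)[aF _ _] _] := famF; have [/(_ i)[aG _ _] _] := famG.
have spec := prod_grid_spec own1 own2 own i (sym_chain_size (allP aF _ CF))
  (sym_chain_size (allP aG _ DG)).
have [uC vD] := grid_sub spec LG uvL.
by exists C, D, L, u, v.
Qed.

(** Let [u ++ v] and [u' ++ v'] be common elements. Coordinates that differ are poles of their
    factor. If only one differs, both chains contain a full line over the other coordinate, which
    would have colours [i] and [j]. If both differ, comparability pairs empty with empty and full
    with full, so [u ++ v] is a pole. *)
Theorem prod_cube_family : cube_family (m + n) (prod_family own1 own2 own F G).
Proof.
have [sF oF] := famF; have [sG oG] := famG.
have sP i := prod_scd own1 own2 own (sF i) (sG i).
split=> // i j s t x y ij sPi tPj xs xt ys yt xy.
have [C [D [L [u [v [CF DG LG Es [Ex uvL uC vD]]]]]]] := prod_mem sPi xs.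
have [C' [D' [L' [u2 [v2 [CF' DG' LG' Et [Ex2 uvL' uC' vD']]]]]]] := prod_mem tPj xt.
have szF l E a : E \in F l -> a \in E -> size a = m by apply: cube_scd_mem.
have szG l E a : E \in G l -> a \in E -> size a = n by apply: cube_scd_mem.
have [/= Eu Ev] : u = u2 /\ v = v2.
  by apply: cat_inj; rewrite -?Ex // (szF _ _ _ CF uC) (szF _ _ _ CF' uC').
subst u2 v2 x; clear Ex2.
move: ys yt; rewrite Es Et => /mapP[[u' v'] uvL2 Ey] /mapP[[u2 v2] uvL2' Ey2].
rewrite /cat_pair /= in Ey Ey2.
have inL i0 E H M a b : E \in F i0 -> H \in G i0 -> M \in grid (word i0 E H) E H ->
    (a, b) \in M -> a \in E /\ b \in H.
  move=> EF HG MG abM.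
  have [[aF _ _] [aG _ _]] := (sF i0, sG i0).
  have spec := prod_grid_spec own1 own2 own i0 (sym_chain_size (allP aF _ EF))
    (sym_chain_size (allP aG _ HG)).
  exact: grid_sub spec MG abM.
have [u'C v'D] := inL _ _ _ _ _ _ CF DG LG uvL2.
have [u2C v2D] := inL _ _ _ _ _ _ CF' DG' LG' uvL2'.
have [Eu Ev] : u' = u2 /\ v' = v2.
  by apply: cat_inj; rewrite -?Ey // (szF _ _ _ CF u'C) (szF _ _ _ CF' u2C).
subst u2 v2; clear Ey2.
have ji : j != i by rewrite eq_sym.
have chF l E : E \in F l -> cube_chain m E by have [/allP H _ _] := sF l; apply: H.
have chG l E : E \in G l -> cube_chain n E by have [/allP H _ _] := sG l; apply: H.
have poleF : u != u' -> pole u /\ pole u'.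
  move=> uu'; split; first exact: (oF _ _ _ _ u u' ij CF CF').
  by apply: (oF _ _ _ _ u' u ij CF CF') => //; rewrite eq_sym.
have poleG : v != v' -> pole v /\ pole v'.
  move=> vv'; split; first exact: (oG _ _ _ _ v v' ij DG DG').
  by apply: (oG _ _ _ _ v' v ij DG DG') => //; rewrite eq_sym.
have [Euu|uu'] := eqVneq u u'.
  subst u'; have vv' : v != v' by apply: contra xy => /eqP vv; rewrite Ey vv.
  have [pv pv'] := poleG vv'.
  have col l E H M : E \in F l -> H \in G l -> M \in grid (word l E H) E H ->
      (u, v) \in M -> (u, v') \in M -> own1 u = l.
    move=> EF HG MG m1 m2.
    have [_ vH] := inL _ _ _ _ _ _ EF HG MG m1; have [_ v'H] := inL _ _ _ _ _ _ EF HG MG m2.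
    case: H HG MG vH v'H => // d H HG MG vH v'H.
    have [sH _ _ ends] := pole_ends (chG _ _ HG) (szG _ _ ^~ HG) vH v'H vv' pv pv'.
    have line := col_owned n3 (chF _ _ EF) (smallF EF) (chG _ _ HG) erefl sH MG.
    by case: ends => [[vd vd']|[vd vd']]; move: m1 m2; rewrite vd vd' => m1 m2; apply: line.
  move: ij; rewrite -val_eqE /= -(col _ _ _ _ CF DG LG uvL uvL2).
  by rewrite (col _ _ _ _ CF' DG' LG' uvL' uvL2') eqxx.
have [pu pu'] := poleF uu'.
have [Evv|vv'] := eqVneq v v'.
  subst v'.
  have row l E H M : E \in F l -> H \in G l -> M \in grid (word l E H) E H ->
      (u, v) \in M -> (u', v) \in M -> own2 v = l.
    move=> EF HG MG m1 m2.
    have [uE _] := inL _ _ _ _ _ _ EF HG MG m1; have [u'E _] := inL _ _ _ _ _ _ EF HG MG m2.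
    case: E EF MG uE u'E => // c E EF MG uE u'E.
    have [sE _ _ ends] := pole_ends (chF _ _ EF) (szF _ _ ^~ EF) uE u'E uu' pu pu'.
    have line := row_owned m3 (chG _ _ HG) (smallG HG) (chF _ _ EF) erefl sE MG.
    by case: ends => [[vd vd']|[vd vd']]; move: m1 m2; rewrite vd vd' => m1 m2; apply: line.
  move: ij; rewrite -val_eqE /= -(row _ _ _ _ CF DG LG uvL uvL2).
  by rewrite (row _ _ _ _ CF' DG' LG' uvL' uvL2') eqxx.
have [pv pv'] := poleG vv'.
have cmp : all2 implb (u ++ v) (u' ++ v') || all2 implb (u' ++ v') (u ++ v).
  have [/allP aP _ _] := sP i; apply: chain_comparable (aP _ sPi) _ _; rewrite Es.
    by rewrite -[u ++ v]/(cat_pair (u, v)) map_f.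
  by rewrite -[u' ++ v']/(cat_pair (u', v')) map_f.
have Fr u1 u3 : u1 \in C -> u3 \in C -> u1 != u3 -> pole u1 -> pole u3 ->
    count id u1 = 0 /\ count id u3 = m \/ count id u1 = m /\ count id u3 = 0.
  move=> u1C u3C u13; rewrite /pole !(szF _ _ _ CF) //.
  have ne : count id u1 <> count id u3.
    by move=> /(chain_rank_inj (chF _ _ CF) u1C u3C) E; rewrite E eqxx in u13.
  case/orP=> /eqP E1 /orP[] /eqP E3; [|by left|by right|]; by rewrite E1 E3 in ne.
have Gr v1 v3 : v1 \in D -> v3 \in D -> v1 != v3 -> pole v1 -> pole v3 ->
    count id v1 = 0 /\ count id v3 = n \/ count id v1 = n /\ count id v3 = 0.
  move=> v1C v3C v13; rewrite /pole !(szG _ _ _ DG) //.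
  have ne : count id v1 <> count id v3.
    by move=> /(chain_rank_inj (chG _ _ DG) v1C v3C) E; rewrite E eqxx in v13.
  case/orP=> /eqP E1 /orP[] /eqP E3; [|by left|by right|]; by rewrite E1 E3 in ne.
rewrite /pole size_cat count_cat (szF _ _ _ CF uC) (szG _ _ _ DG vD).
have szu : size u = size u' by rewrite (szF _ _ _ CF uC) (szF _ _ _ CF u'C).
case: (Fr _ _ uC u'C uu' pu pu') (Gr _ _ vD v'D vv' pv pv') =>
  [[u0 u'm]|[um u'0]] [[v0 v'n]|[vn v'0]].
- by rewrite u0 v0.
(* Here one coordinate goes up and the other down, so the two elements are incomparable. *)
- move: cmp; rewrite !all2_cat // => /orP[]/andP[/all2_implb_count lu /all2_implb_count lv].
    by rewrite vn v'0 leqNgt (ltn_trans _ n3) in lv.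
  by rewrite u'm u0 leqNgt (ltn_trans _ m3) in lu.
- move: cmp; rewrite !all2_cat // => /orP[]/andP[/all2_implb_count lu /all2_implb_count lv].
    by rewrite um u'0 leqNgt (ltn_trans _ m3) in lu.
  by rewrite v'n v0 leqNgt (ltn_trans _ n3) in lv.
- by rewrite um vn eqxx orbT.
Qed.

(** By [grid_small] a small chain contains both innermost points, and [turns] takes the first number
    of letters for which one of them has colour [i]. *)
Lemma prod_colors_small :
  (forall i C D, C \in F i -> D \in G i -> nearly_square C D ->
     exists2 a, a <= hook_count C D & owned_turn own i C D a) ->
  colors_small own (prod_family own1 own2 own F G).
Proof.
move=> ownP i s /flattenP[_ /allpairsP[[C D] [/= CF DG ->]]] /mapP[L LG ->].
rewrite size_map => sL; have [/(_ i)[aF _ _] _] := famF; have [/(_ i)[aG _ _] _] := famG.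
have spec := prod_grid_spec own1 own2 own i (sym_chain_size (allP aF _ CF))
  (sym_chain_size (allP aG _ DG)).
have [sCD sDC] := grid_small [::] [::] spec LG sL.
have cl : nearly_square C D by rewrite /nearly_square sCD.
have [a al oa] := ownP _ _ _ CF DG cl.
have hasa : has (owned_turn own i C D) (iota 0 (hook_count C D).+1).
  by apply/hasP; exists a => //; rewrite mem_iota.
have := nth_find 0 hasa; move: hasa; rewrite has_find size_iota ltnS => fl.
rewrite nth_iota // add0n {1}/owned_turn /turns cl (minn_idPr fl).
case: (innermost _ _ _ _ _) => z z' /= /orP[] oz zL z'L; rewrite has_map; apply/hasP.
  by exists z.
by exists z'.
Qed.

(** As the number of letters [true] grows from [0] to [hook_count C D], the lower innermost point
    visits these positions of [D]. In a near-square this misses at most the last position, which the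
    upper innermost point reaches for the largest number. *)
Lemma prod_colors_small_right :
  (forall u, own u = own2 (drop m u)) ->
  (forall i D, D \in G i -> has (fun v => own2 v == i) D) ->
  colors_small own (prod_family own1 own2 own F G).
Proof.
move=> ownE ownG; apply: prod_colors_small => i C D CF DG cl.
have [sF _] := famF; have [/allP aF _ _] := sF i.
have C0 := sym_chain_size (aF _ CF).
have own_nth r t : r < size C -> own2 (nth [::] D t) == i ->
    own (nth [::] C r ++ nth [::] D t) == i.
  move=> rC; rewrite ownE drop_size_cat //.
  by rewrite (cube_scd_mem (sF i) CF) // mem_nth.
have D0 : has (fun v => own2 v == i) D by apply: ownG.
have := nth_find [::] D0; move: D0; rewrite has_find; move: (find _ D) => t tD ot.
have [tl|lt] := leqP t (hook_count C D).
  exists t => //; apply/orP; left; apply: own_nth.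
    rewrite countC_turn_word /hook_count; move: (size C) (size D) C0; lia.
  by rewrite count_turn_word.
exists (hook_count C D) => //; apply/orP; right; apply: own_nth.
  by apply: leq_ltn_trans (leq_subr _ _) _; rewrite ltn_predL.
rewrite countC_turn_word subnn subn0.
suff <- : t = (size D).-1 by [].
by move: cl lt tD; rewrite /nearly_square /hook_count; move: (size C) (size D) C0; lia.
Qed.
End Product.

(** * The cubes of dimension 7, 11 and 14 *)

Fixpoint cube n : seq bitseq :=
  if n is n'.+1 then map (cons false) (cube n') ++ map (cons true) (cube n') else [:: [::]].

Lemma size_cube n : size (cube n) = 2 ^ n.
Proof. by elim: n => //= n IH; rewrite size_cat !size_map IH expnS; lia. Qed.

Lemma mem_cube n u : (u \in cube n) = (size u == n).
Proof.
elim: n u => [|n IH] [|b u] /=; rewrite ?inE ?eqSS -?IH // mem_cat.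
  by apply/norP; split; apply/mapP=> -[].
case: b; last first.
  rewrite [X in _ || X](_ : _ = false) ?orbF; last by apply/mapP=> -[].
  by rewrite mem_map // => x y [].
rewrite [X in X || _](_ : _ = false) /=; last by apply/mapP=> -[].
by rewrite mem_map // => x y [].
Qed.

(** * Executable checks of decompositions *)

(** Prefix trees make a lookup linear in the dimension, which keeps the evaluation of the checks
    feasible. *)
Inductive trie (A : Type) := Empty | Leaf of A | Node of trie A & trie A.
Arguments Empty {A}.

Fixpoint insert (A : Type) (u : bitseq) (a : A) (t : trie A) : trie A :=
  if u is b :: u' then
    let: (l, r) := if t is Node l r then (l, r) else (Empty, Empty) in
    if b then Node l (insert u' a r) else Node (insert u' a l) r
  else Leaf a.

Fixpoint lookup (A : Type) (d : A) (t : trie A) (u : bitseq) : A :=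
  match t, u with
  | Leaf a, [::] => a
  | Node l r, b :: u' => lookup d (if b then r else l) u'
  | _, _ => d
  end.

Definition trie_of (A : Type) (s : seq (bitseq * A)) : trie A :=
  foldr (fun z => insert z.1 z.2) Empty s.

Definition label_trie (D : seq (seq bitseq)) : trie bitseq :=
  trie_of (flatten [seq [seq (u, head [::] s) | u <- s] | s <- D]).

(* Disjointness of chains is tested by looking up labels: [t] maps every element
   of a chain to the first element of that chain. *)
Definition check_scd n (t : trie bitseq) (D : seq (seq bitseq)) : bool :=
  [&& all (fun s => cube_chain n s && all (fun u => (size u == n) &&
        (lookup [::] t u == head [::] s)) s) D,
      uniq [seq head [::] s | s <- D] & size (flatten D) == 2 ^ n].

(** [t] labels the chains of another decomposition. A label that occurs once on [s] belongs to a
    chain sharing a single element with [s]. *)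
Definition check_cross (t : trie bitseq) (D : seq (seq bitseq)) : bool :=
  all (fun s => let labels := [seq lookup [::] t u | u <- s] in
    all (fun u => pole u || (count_mem (lookup [::] t u) labels == 1)) s) D.

Definition check_family n (Fs : seq (seq (seq bitseq))) : bool :=
  let ts := map label_trie Fs in
  all (fun i => check_scd n (nth Empty ts i) (nth [::] Fs i) &&
    all (fun j => (i == j) || check_cross (nth Empty ts i) (nth [::] Fs j)) (iota 0 4))
    (iota 0 4).

Definition check_colors (own : bitseq -> nat) (p : pred (seq bitseq))
    (Fs : seq (seq (seq bitseq))) : bool :=
  all (fun i => all (fun s => p s ==> has (fun u => own u == i) s) (nth [::] Fs i)) (iota 0 4).

Definition family_of (Fs : seq (seq (seq bitseq))) (i : 'I_4) := nth [::] Fs i.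

Lemma check_colorsP own p Fs : check_colors own p Fs ->
  forall (i : 'I_4) s, s \in family_of Fs i -> p s -> has (fun u => own u == i) s.
Proof.
move=> /allP H i s sD ps; have := H i; rewrite mem_iota ltn_ord => /(_ isT)/allP/(_ s sD).
by rewrite ps.
Qed.

Lemma uniq_flatten_labels (A B : eqType) (h : seq A -> B) (lab : A -> B) D :
  {in D, forall s, uniq s} ->
  (forall s u, s \in D -> u \in s -> lab u = h s) ->
  uniq (map h D) -> uniq (flatten D).
Proof.
elim: D => //= s D IH uD lD /andP[hs uh]; rewrite cat_uniq uD ?mem_head //=.
rewrite IH //; first 1 last.
- by move=> t tD; apply: uD; rewrite inE tD orbT.
- by move=> t u tD; apply: lD; rewrite inE tD orbT.
rewrite andbT; apply/hasPn=> u /flattenP[t tD ut]; apply: contra hs => us.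
apply/mapP; exists t => //.
by rewrite -(lD _ _ (mem_head _ _) us) (lD t) // inE tD orbT.
Qed.

(** Distinct labels make the chains disjoint; [2 ^ n] distinct elements of the cube then exhaust
    it. *)
Lemma check_scdP n t D : check_scd n t D -> cube_scd n D.
Proof.
case/and3P=> /allP H uh /eqP sz.
have chD s : s \in D -> cube_chain n s by move=> /H/andP[].
have uD : uniq (flatten D).
  apply: (@uniq_flatten_labels _ _ (head [::]) (lookup [::] t)) => //.
    by move=> s /chD/chain_uniq.
  by move=> s u /H/andP[_ /allP lab] /lab/andP[_ /eqP].
split=> //; first by apply/allP.
have sub : {subset flatten D <= cube n}.
  by move=> u /flattenP[s /H/andP[_ /allP lab] /lab/andP[su _]]; rewrite mem_cube.
have [|_ E] := uniq_min_size uD sub; first by rewrite size_cube sz.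
by move=> u; rewrite E mem_cube.
Qed.

Lemma check_familyP n Fs : check_family n Fs -> cube_family n (family_of Fs).
Proof.
(* The tries become variables: [check_scd] verifies their labels, so nothing about their
   construction has to be proved. *)
rewrite /check_family; move: (map _ _) => ts /allP H.
have {}H (i : 'I_4) := H i; split=> [i|i j s t x y ij sF tF xs xt ys yt xy].
  by have := H i; rewrite mem_iota ltn_ord => /(_ isT)/andP[/check_scdP].
have := H j; rewrite mem_iota ltn_ord => /(_ isT)/andP[/and3P[/allP lab _ _] /allP cross].
have labE u : u \in t -> lookup [::] (nth Empty ts j) u = head [::] t.
  by move=> ut; have /andP[_ /allP/(_ u ut)/andP[_ /eqP]] := lab _ tF.
have ji : (val j == val i) = false by rewrite (inj_eq val_inj) eq_sym; apply/negbTE.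
have := cross i; rewrite mem_iota ltn_ord ji.
move=> /(_ isT)/allP/(_ s sF)/allP/(_ x xs)/orP[//|].
rewrite labE // count_map -size_filter => /eqP sz1.
have : uniq [:: x; y] by rewrite /= inE xy.
move=> /uniq_leq_size/(_ _)/=.
move=> /(_ [seq u <- s | preim (lookup [::] (nth Empty ts j)) (pred1 (head [::] t)) u]).
rewrite sz1; suff sub : {subset [:: x; y] <=
    [seq u <- s | preim (lookup [::] (nth Empty ts j)) (pred1 (head [::] t)) u]} by move/(_ sub).
by move=> u; rewrite !inE mem_filter /= => /orP[]/eqP->; rewrite labE // eqxx.
Qed.

(* A list p of distinct elements of {0, ..., n-1} encodes the symmetric chain
   that starts with the set of the first n - size p elements of p and adds the
   remaining ones in the given order. *)
Definition initial_set n (p : seq nat) : bitseq := [seq i \in p | i <- iota 0 n].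

Definition base_chain n (p : seq nat) : seq bitseq :=
  [seq initial_set n (take j p) | j <- iota (n - size p) (2 * size p - n).+1].

Definition rotations n (s : seq bitseq) : seq (seq bitseq) :=
  [seq map (rot r) s | r <- iota 0 n].

(* For prime n the proper nonempty subsets are decomposed invariantly under
   rotation; one chain of the orbit of the first p is extended by the empty set
   and the full set. *)
Definition cyclic_chains n (P : seq (seq nat)) : seq (seq bitseq) :=
  let D := flatten [seq rotations n (base_chain n p) | p <- P] in
  (nseq n false :: rcons (head [::] D) (nseq n true)) :: behead D.

(* The lists below were found by computer search. *)
Definition chains7 : seq (seq (seq nat)) := [::
  [:: [:: 0; 2; 3; 6; 1; 5];
      [:: 0; 1; 4; 6; 2];
      [:: 0; 3; 5; 2; 6];
      [:: 0; 1; 2; 3];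
      [:: 0; 1; 3; 6]];
  [:: [:: 1; 0; 3; 2; 5; 4];
      [:: 0; 2; 1; 4; 3];
      [:: 0; 3; 6; 4; 2];
      [:: 0; 2; 3; 5];
      [:: 0; 2; 4; 3]];
  [:: [:: 3; 6; 4; 0; 1; 2];
      [:: 0; 1; 6; 5; 4];
      [:: 0; 2; 4; 5; 3];
      [:: 0; 2; 3; 4];
      [:: 0; 1; 4; 2]];
  [:: [:: 4; 2; 0; 1; 6; 5];
      [:: 0; 1; 2; 5; 4];
      [:: 0; 3; 2; 1; 4];
      [:: 0; 1; 3; 5];
      [:: 0; 1; 4; 3]]].

(* The number is the position in the chain of the element coloured by the index
   of the decomposition; the colouring is invariant under rotation. *)
Definition chains11 : seq (seq (nat * seq nat)) := [::
  [:: (0, [:: 0; 5; 9; 10; 2; 8; 3; 6; 7; 1]);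
      (0, [:: 0; 4; 7; 3; 10; 9; 6; 8; 2]);
      (0, [:: 0; 3; 10; 4; 8; 6; 5; 1; 9]);
      (0, [:: 0; 2; 3; 5; 9; 4; 6; 8; 7]);
      (0, [:: 0; 10; 1; 5; 6; 2; 9; 3; 4]);
      (1, [:: 0; 2; 5; 1; 6; 7; 9; 3]);
      (0, [:: 0; 4; 10; 5; 8; 9; 7; 3]);
      (0, [:: 0; 3; 6; 10; 2; 9; 5; 7]);
      (0, [:: 0; 3; 5; 4; 10; 2; 8; 9]);
      (1, [:: 0; 2; 4; 10; 3; 8; 1; 9]);
      (0, [:: 0; 4; 5; 7; 3; 9; 6; 2]);
      (0, [:: 0; 4; 9; 3; 7; 8; 5; 6]);
      (1, [:: 0; 3; 4; 6; 2; 7; 8; 1]);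
      (2, [:: 0; 2; 10; 9; 3; 4; 1; 7]);
      (0, [:: 0; 5; 10; 8; 2; 4; 6; 3]);
      (1, [:: 0; 2; 4; 6; 8; 9; 5]);
      (0, [:: 0; 4; 7; 9; 5; 8; 2]);
      (0, [:: 0; 7; 9; 10; 1; 4; 8]);
      (0, [:: 0; 4; 5; 9; 8; 1; 2]);
      (1, [:: 0; 1; 3; 4; 2; 10; 6]);
      (0, [:: 0; 2; 4; 5; 10; 6; 7]);
      (1, [:: 0; 5; 6; 8; 1; 9; 3]);
      (0, [:: 0; 1; 4; 6; 10; 2; 5]);
      (0, [:: 4; 5; 6; 7; 9; 2; 1]);
      (0, [:: 4; 6; 7; 10; 5; 9; 3]);
      (1, [:: 0; 3; 6; 8; 10; 2; 9]);
      (1, [:: 0; 2; 5; 7; 8; 9; 10]);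
      (0, [:: 0; 4; 8; 10; 6; 5; 9]);
      (0, [:: 1; 4; 7; 8; 9; 3; 2]);
      (1, [:: 0; 2; 4; 7; 3; 9; 5]);
      (0, [:: 0; 1; 3; 4; 6; 10]);
      (0, [:: 0; 4; 7; 9; 10; 8]);
      (0, [:: 0; 2; 5; 6; 8; 3]);
      (0, [:: 2; 4; 5; 7; 8; 6]);
      (0, [:: 0; 1; 2; 7; 10; 5]);
      (1, [:: 1; 4; 7; 8; 10; 2]);
      (1, [:: 0; 3; 4; 6; 7; 8]);
      (0, [:: 0; 4; 6; 7; 9; 3]);
      (0, [:: 0; 2; 5; 6; 7; 10]);
      (1, [:: 0; 2; 4; 5; 6; 8]);
      (0, [:: 0; 2; 4; 9; 10; 1]);
      (0, [:: 0; 1; 2; 3; 7; 4])];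
  [:: (6, [:: 2; 4; 0; 3; 7; 1; 8; 6; 9; 10]);
      (5, [:: 0; 3; 6; 1; 2; 9; 4; 7; 10]);
      (5, [:: 0; 1; 8; 6; 5; 7; 3; 10; 9]);
      (0, [:: 0; 6; 2; 1; 10; 4; 3; 9; 5]);
      (5, [:: 0; 4; 10; 2; 9; 6; 3; 7; 5]);
      (3, [:: 0; 1; 3; 9; 5; 6; 2; 4]);
      (1, [:: 0; 2; 3; 10; 4; 5; 7; 8]);
      (4, [:: 0; 3; 5; 6; 7; 1; 9; 10]);
      (4, [:: 0; 4; 5; 2; 1; 9; 7; 3]);
      (0, [:: 0; 3; 9; 5; 4; 6; 1; 7]);
      (0, [:: 0; 1; 4; 8; 9; 3; 2; 5]);
      (5, [:: 0; 5; 6; 9; 3; 10; 1; 2]);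
      (0, [:: 0; 1; 2; 7; 5; 4; 6; 10]);
      (0, [:: 0; 2; 7; 10; 8; 9; 3; 1]);
      (0, [:: 0; 4; 7; 9; 3; 1; 8; 2]);
      (0, [:: 0; 2; 4; 9; 3; 1; 7]);
      (1, [:: 0; 4; 5; 7; 2; 9; 6]);
      (0, [:: 0; 4; 5; 10; 1; 7; 6]);
      (1, [:: 0; 2; 3; 7; 6; 10; 9]);
      (1, [:: 5; 6; 7; 10; 8; 0; 2]);
      (0, [:: 0; 3; 7; 9; 5; 6; 2]);
      (2, [:: 0; 2; 3; 6; 5; 7; 10]);
      (0, [:: 0; 1; 7; 10; 3; 9; 2]);
      (0, [:: 0; 3; 6; 9; 4; 8; 1]);
      (3, [:: 0; 4; 7; 10; 2; 1; 3]);
      (0, [:: 0; 3; 4; 10; 5; 1; 9]);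
      (2, [:: 0; 7; 8; 9; 10; 1; 6]);
      (0, [:: 0; 3; 7; 8; 2; 4; 6]);
      (1, [:: 0; 4; 6; 10; 8; 1; 5]);
      (2, [:: 0; 1; 2; 3; 8; 4; 6]);
      (0, [:: 0; 1; 4; 7; 10; 8]);
      (0, [:: 0; 4; 5; 9; 10; 3]);
      (1, [:: 0; 2; 6; 7; 9; 3]);
      (0, [:: 0; 5; 7; 8; 9; 4]);
      (0, [:: 0; 3; 6; 8; 9; 1]);
      (0, [:: 0; 1; 3; 5; 6; 10]);
      (0, [:: 0; 2; 6; 7; 10; 1]);
      (0, [:: 0; 4; 5; 6; 8; 2]);
      (0, [:: 1; 3; 4; 5; 6; 10]);
      (1, [:: 0; 3; 4; 7; 10; 5]);
      (1, [:: 0; 1; 3; 4; 8; 6]);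
      (1, [:: 0; 3; 5; 7; 8; 4])];
  [:: (6, [:: 1; 10; 7; 6; 2; 9; 8; 5; 3; 4]);
      (6, [:: 0; 7; 9; 5; 1; 8; 4; 2; 10]);
      (7, [:: 0; 5; 6; 4; 3; 2; 8; 1; 10]);
      (6, [:: 0; 1; 4; 3; 7; 2; 10; 8; 9]);
      (6, [:: 0; 3; 4; 5; 9; 2; 10; 6; 8]);
      (2, [:: 0; 1; 2; 5; 10; 6; 7; 3]);
      (4, [:: 0; 1; 5; 4; 2; 7; 3; 6]);
      (4, [:: 0; 5; 9; 3; 8; 10; 7; 1]);
      (5, [:: 0; 5; 7; 8; 9; 3; 1; 2]);
      (4, [:: 0; 1; 3; 6; 9; 7; 8; 2]);
      (4, [:: 0; 3; 7; 2; 5; 6; 1; 9]);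
      (4, [:: 0; 2; 5; 3; 10; 7; 8; 9]);
      (3, [:: 0; 5; 8; 2; 7; 10; 1; 9]);
      (4, [:: 0; 1; 7; 5; 8; 2; 4; 10]);
      (0, [:: 0; 1; 9; 7; 4; 5; 3; 6]);
      (2, [:: 0; 2; 3; 4; 10; 9; 6]);
      (2, [:: 0; 1; 4; 7; 2; 6; 8]);
      (0, [:: 0; 1; 2; 4; 10; 3; 8]);
      (0, [:: 0; 4; 9; 10; 2; 7; 3]);
      (1, [:: 0; 4; 5; 10; 3; 7; 2]);
      (0, [:: 0; 5; 7; 10; 6; 8; 3]);
      (0, [:: 0; 3; 7; 10; 1; 2; 6]);
      (1, [:: 0; 2; 5; 9; 6; 7; 4]);
      (2, [:: 0; 3; 5; 7; 9; 2; 8]);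
      (1, [:: 0; 1; 3; 5; 7; 2; 10]);
      (2, [:: 0; 4; 5; 7; 1; 3; 6]);
      (2, [:: 0; 1; 2; 3; 4; 6; 5]);
      (2, [:: 0; 1; 5; 8; 10; 2; 6]);
      (1, [:: 0; 1; 3; 8; 4; 7; 6]);
      (0, [:: 0; 1; 6; 9; 7; 4; 5]);
      (1, [:: 0; 1; 3; 7; 9; 10]);
      (1, [:: 0; 2; 3; 4; 5; 10]);
      (1, [:: 0; 3; 7; 9; 10; 4]);
      (1, [:: 0; 1; 2; 6; 7; 8]);
      (0, [:: 0; 1; 2; 7; 9; 6]);
      (1, [:: 1; 2; 3; 4; 8; 9]);
      (1, [:: 0; 1; 3; 6; 7; 8]);
      (1, [:: 0; 1; 4; 7; 10; 2]);
      (0, [:: 0; 1; 2; 5; 7; 9]);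
      (0, [:: 0; 1; 3; 5; 8; 4]);
      (0, [:: 0; 1; 4; 7; 8; 9]);
      (1, [:: 0; 1; 6; 8; 9; 4])];
  [:: (4, [:: 3; 4; 10; 0; 9; 2; 7; 5; 1; 6]);
      (5, [:: 0; 6; 3; 4; 9; 7; 5; 1; 8]);
      (5, [:: 0; 7; 4; 1; 10; 5; 8; 6; 9]);
      (5, [:: 0; 9; 4; 5; 3; 1; 7; 8; 2]);
      (6, [:: 0; 3; 5; 1; 8; 7; 6; 2; 10]);
      (3, [:: 0; 6; 7; 5; 8; 4; 2; 3]);
      (3, [:: 0; 9; 10; 2; 7; 4; 5; 1]);
      (3, [:: 0; 5; 6; 2; 4; 7; 3; 9]);
      (0, [:: 0; 2; 10; 1; 8; 9; 3; 4]);
      (5, [:: 0; 2; 3; 8; 10; 5; 9; 1]);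
      (4, [:: 0; 3; 9; 7; 1; 6; 10; 2]);
      (0, [:: 0; 3; 4; 2; 8; 7; 5; 9]);
      (3, [:: 0; 5; 9; 7; 4; 3; 10; 8]);
      (0, [:: 0; 7; 9; 4; 6; 8; 5; 1]);
      (5, [:: 0; 3; 10; 8; 6; 5; 2; 9]);
      (0, [:: 0; 3; 8; 9; 7; 4; 10]);
      (3, [:: 0; 2; 5; 8; 3; 4; 10]);
      (0, [:: 0; 4; 5; 7; 6; 3; 8]);
      (2, [:: 0; 1; 3; 4; 8; 9; 7]);
      (0, [:: 0; 4; 5; 6; 1; 10; 9]);
      (3, [:: 0; 6; 9; 10; 1; 3; 5]);
      (0, [:: 0; 4; 6; 9; 2; 3; 10]);
      (2, [:: 0; 3; 4; 7; 9; 2; 6]);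
      (2, [:: 0; 2; 3; 7; 4; 6; 1]);
      (2, [:: 0; 3; 4; 8; 10; 9; 2]);
      (0, [:: 0; 2; 3; 5; 1; 10; 8]);
      (3, [:: 0; 5; 6; 9; 8; 10; 1]);
      (3, [:: 0; 3; 9; 10; 2; 6; 7]);
      (3, [:: 0; 2; 3; 9; 7; 5; 1]);
      (3, [:: 0; 5; 6; 10; 1; 9; 7]);
      (0, [:: 0; 1; 7; 8; 10; 4]);
      (1, [:: 0; 3; 6; 7; 10; 2]);
      (0, [:: 0; 3; 5; 6; 10; 1]);
      (1, [:: 0; 3; 4; 6; 10; 1]);
      (1, [:: 0; 1; 3; 6; 7; 5]);
      (0, [:: 1; 5; 6; 8; 9; 3]);
      (1, [:: 0; 1; 2; 3; 10; 8]);
      (1, [:: 0; 2; 7; 8; 9; 6]);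
      (1, [:: 0; 1; 6; 7; 9; 8]);
      (1, [:: 0; 3; 5; 9; 10; 6]);
      (0, [:: 0; 4; 7; 8; 9; 5]);
      (1, [:: 0; 2; 3; 6; 8; 1])]].

(* The colours of the elements u ++ v of Q_14: one row for each u in [cube 7], with
   the colours for v in [cube 7] as base 4 digits, least significant first. *)
Definition color_table14 : seq N := [::
  0x004520002940029018850111021b87100680802441152734200815bc80580400;
  0x1900c04001005290000501114a1b87011200106401142730604814bc80480000;
  0x1900f0400200525000c501114a1b470111c0d06401142730504814bc40480000;
  0x68b79c3c94e00cc07768e80000c0c0128f4c4800f88100043000c100c0100400;
  0xd9c00040c1006350c0090111471e4701d10020b401143730508c14fc40480000;
  0x3f1e3ed5fe1fe554cdd916d5f9545451f1f5e5941555d446dd94554154514514;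
  0x68b79c3c94e00c403768e80000c040128d4c4800f88100041000c10040100400;
  0x123b0eec0af8eae0323afc82ef8bcb213f282ca8eec2a33af888a2bdc0ad0915;
  0xd180b0408100525080c501114a1b470191c0d06401142730504814bc404c0000;
  0x6c30f430fd501c30dfd7540134c00c11c4ccd44c774100040040f10000d00400;
  0x3f1e0ed5fe1fe554cd1916d5f9545451f13525941555d446dd94554154514514;
  0x00714d264ae72b1a7229e95e1f9d35ab4c1a2bb6e99675d806be96d42e64a883;
  0x68b79c3c94e00c403768e80000c040128d4c4800f88100041000c10040100400;
  0xc60901b808149f73031714439bcf4f3d211c147f3743733f944ff0ff43ff3cff;
  0x123b0eec0af8eae0323afc82ef8bcb213f282ca8eec2a33af888a2bdc0ad0915;
  0x0092b3983f3cb4728dff3ee2b8604c29a1f4fcce1feac8089cc27a0042e02880;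
  0x1900c04001005250000501114a1b47011100106401142630504814bc40480000;
  0x3ce8b430fd511c30dfd7530104c00c11c4ccd44c774100040040f10000d00400;
  0x3ce8f430fd511c30dfd7540104c00c11c4ccd44c774100040040f10000d00400;
  0x2b9cb7d2bd4fd62a9dc646eef66939a9b4f6d36a522ae9d8ce7a6a942ea4a880;
  0x3f32f3d53ed9e5543dd9d695e95454513de5e594d5559446d994554154514514;
  0xd6e36aaf68b08ade12b9bd1d8299f5da6b8b8f26add525d4b33a9594fe54e480;
  0x00714d264ae72b1a7229e95e1f9d35ab4c1a2bb6e99675d806be96d42e64a883;
  0x00732e2f29cb1adc3a85c19d2698f4d10fab9364e115a4c73b789581fc51c515;
  0x68b79c3c94e00c403768e80000c040128d4c4800f88100041000c10040100400;
  0x2b9cb7d2bd4fd62a9dc642eef66939a9b4f6d36a522aebd8ce7a6a942ea4a880;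
  0x6682e9b8aa94af73ab9b944397cf4f3da99c84bfb743733c948ff2ff43fc3cc0;
  0x21851362976f7b9b966d69dd4f9fb79f967a7bf76995f6f46eff95fcaf5cb4c1;
  0x123b0eec0af8ebe0323afc82ee8fcb213f282cb8eec2b33af88ca2fdc0ad0915;
  0x00012330090c1e200b8600f136f8091200bc9068323dec040c48ed8000900400;
  0x0092b3983f3cb4728dff3ee2b8604c29a1f4fcce1feac8089cc27a0042e02880;
  0x200300cf0000c1be00030139c205adda3203001e033d1d94e3263d54b2d4e482;
  0x86016c80420092a0408803318a39890162809068023c2d10a0482c9480840000;
  0x031e3ed53e1fe5540dd916d5f954545131f5e5941555d446dd94554154514514;
  0x3ce8b430fd511c30dfd7530104c00c11c4ccd44c774100040040f10000d00400;
  0x6682e9b86a94afb3ab9b944397cf8f3daa9ca4bfb743733ca48ff2fc83fc3dc0;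
  0x3ce8f430fd511c30dfd7540104c00c11c4ccd44c774100040040f10000d00400;
  0x166368af68b88ade12b9bd9da299f5da6bab8f26add5a5d4bb3a9594fe54e480;
  0x2b9cb7d2bd4fd62a9dc646eef66939a9b4f6d36a522ae9d8ce7a6a942ea4a880;
  0x00012330090c1e200b8600f136f8091200bc9068323dec040c48ed8000900400;
  0x3f1ec2d5fe1fe554cd1916d5f9545451f13525941555d446dd94554154514514;
  0x16e36baf48ba8ade12b9bd9d8299f5da6bab8f26add5a5d4bb3a9594fe54e480;
  0x16e36baf68b88ade12b9bd9da299f5da6bab8f26add5a5d4bb3a9594fe54e480;
  0x00002302293f131808b53ddd371c349100b21f740dd5f4c60e7c15c12c518515;
  0x10704d264ae72b1a7229e95e1f9d35ab4c1a2bb6e99675d806be96d42e64a883;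
  0x000020022933131838b53d1d271c349100821f740dd534c6027c15c12c518515;
  0x00732e2f29cb1adc3a85c19d2698f4d10fab9364e115a4c73b789581fc51c515;
  0x0033130e17e533e8346eea621f2cd8a10f5279f8caaa784b36dc2ac2e4a18a2a;
  0x68b79c3c94e00c403768e80000c040128d4c4800f88100041000c10040100400;
  0x00714d264ae72b1a7229e95e1f9d35ab4c1a2bb6e99675d806be96d42e64a883;
  0x2b9cb7d2bd4fd62a9dc642eef66939a9b4f6d36a522ae9d8ce7a6a942ea4a880;
  0x21859362972f7b5b866d29dd4f9f779f917a7bf72995f7f45eff95fc6f5cb4c1;
  0x1402e9382a942f732b9b944317cf4f3d099ca4bfb743733c148ff2fc43fc3cc0;
  0x00002302293f131808b53ddd371c349100b21f740dd5f4c60e7c15c12c518515;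
  0x29859342972f735b866d29dd4f1f779f91727bf70995f7f45eff15fc6f5cb4c1;
  0x0000003303023f2c032e0a3902ec28d3000f32f83abd388603ecedc13891c517;
  0x123b0eec0af8eae0323afc82ef8bcb213f282ca8eec2a33af888a2bdc0ad0915;
  0x00732e2f29cb1adc3a85c19d2698f4d10fab9364e115a4c73b789581fc51c515;
  0x00012330090c1e200b8600f136f8091200bc9068323dec040c48ed8000900400;
  0x0000003303023f2c032e0a3902ec28d3000f32f83abd388603ecedc13891c517;
  0x0092b3983f3cb4728dff3ee2b8604c29a1f4fcce1feac8089cc27a0042e02880;
  0x0030130217e53328346eea621f2c18a10c5279f8caaa784b06dc2ac2e4a18a2a;
  0x200300cf0000c1be00030139c205adda3203001e033d1d94e3263d54b2d4e482;
  0x000000030002223e0003023908391de9000301ae033e2158032a3f9436e4e881;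
  0x0916f95b1116565c05d595595a5854d111d7d56415556444575855807450c401;
  0x14331c3c24e02c403368e80000c040120d4c6880f88100041080c10048100400;
  0x3f1e0ed5fe1fe554cd1916d5f9545451f13525941555d446dd94554154514514;
  0x123b0eac0af8aae0323afc82af8bcb212f282ca8eec2a33ab888a2bdc0ad0915;
  0xbcebf430fd511c30dfd4540104c00c11c4ccd44c774100040040f10000d00400;
  0x00714d264ae72b1a7229e95e1f9d35ab4c1a2bb6e99675d806be96d42e64a883;
  0x1202e9b82994af732b9b944397cf4f3d299ca4bfb743733f948ff2fc43fc3cc0;
  0x0492b3183f3c34728dff3ee238604c2981f4fcce1feac8081cc27a0042e02880;
  0x3ce8b430fd911c70efd7530104c00c11c9ccd44cb74100041040f10040d00400;
  0x2b9cb7d2bd4fd62a9dc646eef66939a9b4f6d36a522ae9d8ce7a6a9422a4a880;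
  0x16e36bac68b88a1212b9bd9da299f51a68a88f26add5a5d4883a95940e542480;
  0x00732e2f29cb1adc3a85c19d2698f4d10fab9364e115a4c73b789581fc51c515;
  0x2b9cb7d2bd4fd62a9dc642eef66939a9b4f6d36a522ae9d8ce7a6a942ea4a880;
  0x29a69b6297af7b5ba66da9dd4f9f779f997a7bf7a995f7f45eff95fc6f5cb4c1;
  0x00012330090c1ee00b8600f136f8091203bc9068323dec043c48ed80c0900400;
  0x200300cf0000c1be00030139c205adda3203001e033d1d94e3263d54b2d4e482;
  0x3fde3ed5fe1fe555cdd915e5f9655559f1f5e5961569d956dd96595556556594;
  0x62822bb8aaa0af73ababa80387cf4f3da98ca8bfbb83333c908ff2fc43fc3cc0;
  0x16636baf68b88ade12b9bd9da299f5da6bab8f26add5a5d4bb3a9594fe54e480;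
  0x00012330090c1e200b8600f136f8091200bc9068323dec040c48ed8000900400;
  0x021c00af28388ade22313d99a299e5d6232b0e252dd5a594bb299594fd54d440;
  0x00002302293f131808b53ddd371c349100b21f740dd5f4c60e7c15c12c518515;
  0x00002302293f131808b53ddd371c349100b21f740dd534c60e7c15c12c518515;
  0x0030130217e53328346eea621f2c18a10f5279f8caaa784b06dc2ac2e4a18a2a;
  0x10704d260ae72b1a7229e95e1f9d35ab4c1a2bb6e99675db06be96d72e67a9bc;
  0x21859362970f7b5b864d01dd4f9f779f977a73f72d1535f75eff95fd6f5db5d4;
  0x00002302293f131808b53d1d371c349100b21f740dd5f4c60e7c15c12c518515;
  0x0000003303023f2c030e232902ec28d3000f30f83229388603ece9c33893c63d;
  0x00332e2f29cb1adc3a85c19d2698f4d10fab9364e115a4c73b789581fc51c515;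
  0x4000003303023e2c032e0a3903e828d3000f32e83abd288603e8ed813891c517;
  0x0033130e17e533e8346eea621f2cd8a10f5279f8caaa784b36dc2ac2e4a18a2a;
  0x000000030002203e000302390a311de90003018e033e015803223f1436e4e881;
  0x0931e47c24e04cc037a8e80040c0c0221f8c8800f88200087000c200c0200800;
  0x123b0eec0af8eae0323afc82ef8bcb013f282ca8eec0a332f888a0bdc08d0115;
  0x00714d264ae72b1a7229e95e1f9d35ab4c1a2bb6e99675d806be96d42e64a883;
  0x005273983f7cb4729dff7ee2b8604c2965f4fcce5feac8089cc27a0082e02880;
  0x2b9cb7d2bd4fd62a9dc642eef66939a9b4f6d36a522ae9d8ce7a6a942ea4a880;
  0x00332e2f29cb1adc3a85c19d2698f4d10fab9364e115a4c73b789581fc51c515;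
  0x21b59e6257eb7b9bb66de99d6f9fb79e9e6a7bf7e995b7f46aff95fcaf5cb4c1;
  0x208380cf0000c1be000301390205addab203001e033d1d94e3263d54f2d4e482;
  0xe28161b4aa24afb38bab284397cf8f3fa29ca8bf3b83733ca48ff2fc83fc3cc0;
  0x00012330090c1e200b8600f136f8091200bc9068323dec040c48ed8000900400;
  0x00002302293f131808b53ddd071c349100b21f740dd5f4c60e7c15c12c518515;
  0x0030130217e52328346eea6a1f2c18a10c5279b8caaa784b069c2ac124a18916;
  0x29859362170f7b5b064d01dd4f9f779f917a73f72115f7f45eff95fc6f5cb4c1;
  0x0000003303023f2c030e023900ec28d3000f32f8323d388603ecedc13091c517;
  0x0040403303023f2c432e0a3902ec28d3400f32f83abd388603ecedc13891c517;
  0x000020030002323e0003023908391de9008301ee033e215803ea3f9436e4e881;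
  0x033b0eac0af8aae0323afc82af8bcb212f282ca8eec2a33ab888a2bdc0ad0915;
  0x02122338033c3cb20bbf3ee238e08c2902bcbcce3feac8082cc2fa0082e02880;
  0x00332e2f29cb1adc3a85c19d2698f4d10fab9364e115a4c73b789581fc51c515;
  0x0003000f000001fe000301390205edda0303001e033d1d9433263d54f2d4e482;
  0x00130330030c2e20030a03c13ac90812003c20a83201e1140c88e19400940400;
  0x00000302002f3168002e2aee3d2478a101323bd80aaad8cb1ef42a4224a18a2a;
  0x0000003303203f2c032e0a3902fc28d2000f32f83abd388603ecedc13891c517;
  0x00000000000222020000023908391129000001a2003e2d58002a0f9406e42881;
  0x209293b8137cbcb21b7f7ee2b8e08c2aa67c7cce7feac808acc2fa0082e02880;
  0x0003000f000001fe000301310205cdd80303001e0331111733063d56fad7e6a8;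
  0x00000312032d3728012e2ae63f6c18a3003639f81aaaf84b0edc6ac2e4a38a2a;
  0x000100030002023e0003023900090de90003202e0332219a032a3f953ae5e994;
  0x200300cf0000c2be00030319c119adda3203002e03152594e32a3594b2d4e482;
  0x000000000002203300230b3908311d2d0000218f0bbe015800233e1407e438c1;
  0x000000070211124e0014173a053b63ea00031562047e23b8136a0dbc362ce882;
  0x000000030000000e00000032003302da00030002003d002503020f293a1de594]%num.

(** * The explicit decompositions and their colours *)

(** Five generators with seven rotations each give the [35] chains; for [Q_11], [42] generators with
    eleven rotations give [462]. *)
Definition scds7 : seq (seq (seq bitseq)) := map (cyclic_chains 7) chains7.

Definition scds11 : seq (seq (seq bitseq)) := map (fun P => cyclic_chains 11 (map snd P)) chains11.

(** Four times [35] chains outnumber the [128] elements, so only the two-element chains are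
    coloured. Two decompositions use the elements of level 3 and two those of level 4. *)
Definition owner7 : trie nat := trie_of (flatten
  [seq [seq (if i < 2 then head [::] s else last [::] s, i) | s <- nth [::] scds7 i & size s == 2]
  | i <- iota 0 4]).

Definition owner11 : trie nat := trie_of (flatten
  [seq flatten [seq [seq (rot r (nth [::] (base_chain 11 z.2) z.1), i) | r <- iota 0 11]
               | z <- nth [::] chains11 i]
  | i <- iota 0 4]).

Fixpoint positive_bits (p : positive) : bitseq :=
  match p with
  | xI p' => true :: positive_bits p'
  | xO p' => false :: positive_bits p'
  | xH => [:: true]
  end.

Fixpoint base4_digits (k : nat) (b : bitseq) : seq nat :=
  if k is k'.+1 then nth false b 0 + (nth false b 1).*2 :: base4_digits k' (drop 2 b) else [::].

(** Bits above the leading one are supplied by the default of [nth], so every row yields all [128]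
    digits. *)
Definition color_row (x : N) : seq nat :=
  base4_digits 128 (if x is Npos p then positive_bits p else [::]).

(** [cube 14] lists [u ++ v] with [u] varying slowest, which is the order of the concatenated
    rows. *)
Definition owner14 : trie nat := trie_of (zip (cube 14) (flatten (map color_row color_table14))).

(* The indices are smaller than 4, so colour 4 means: no colour. *)
Definition own7 := lookup 4 owner7.
Definition own11 := lookup 4 owner11.
Definition own14 := lookup 4 owner14.

Definition scds14 : seq (seq (seq bitseq)) :=
  [seq flatten [seq prod_chains own7 own7 own14 i C D
                | C <- nth [::] scds7 i, D <- nth [::] scds7 i]
  | i <- iota 0 4].

Lemma family7 : cube_family 7 (family_of scds7).
Proof. by apply: check_familyP; vm_cast_no_check (erefl true). Qed.

Lemma colors7 : colors_small own7 (family_of scds7).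
Proof.
have H : check_colors own7 (fun s => size s <= 2) scds7 by vm_cast_no_check (erefl true).
by move=> i s sF s2; apply: check_colorsP H i s sF s2.
Qed.

Lemma family11 : cube_family 11 (family_of scds11).
Proof. by apply: check_familyP; vm_cast_no_check (erefl true). Qed.

(** Evaluated on all chains, not only the small ones; this allows [Q_11] to be a second factor in
    [colorable_add]. *)
Lemma colors11 (i : 'I_4) s : s \in family_of scds11 i -> has (fun u => own11 u == i) s.
Proof.
have H : check_colors own11 predT scds11 by vm_cast_no_check (erefl true).
by move=> sF; apply: check_colorsP H i s sF isT.
Qed.

Lemma colors14 (i : 'I_4) s : s \in family_of scds14 i -> has (fun u => own14 u == i) s.
Proof.
have H : check_colors own14 predT scds14 by vm_cast_no_check (erefl true).
by move=> sF; apply: check_colorsP H i s sF isT.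
Qed.

(** This is an instance of the product theorem; for [Q_14] only the colours are checked by
    evaluation. *)
Lemma family14 : cube_family 14 (family_of scds14).
Proof.
have [sF oF] := @prod_cube_family _ own7 own7 own14 7 7 _ _ isT isT family7 family7 colors7 colors7.
have E (i : 'I_4) : family_of scds14 i =
    prod_family own7 own7 own14 (family_of scds7) (family_of scds7) i.
  by rewrite /family_of (nth_map 0) ?size_iota // nth_iota.
by split=> [i|i j s t x y]; rewrite !E; [apply: sF | apply: oF].
Qed.

(** * Dimensions reached by products *)

Definition colorable n := exists (F : 'I_4 -> seq (seq bitseq)) (own : bitseq -> nat),
  cube_family n F /\ colors_small own F.

(** The product is coloured through its second factor, so colours on the small chains of the first
    suffice. *)
Lemma colorable_add m n (G : 'I_4 -> seq (seq bitseq)) (own2 : bitseq -> nat) :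
  3 < m -> 3 < n ->
  cube_family n G -> (forall i s, s \in G i -> has (fun u => own2 u == i) s) ->
  colorable m -> colorable (m + n).
Proof.
move=> m3 n3 famG colG [F [own1 [famF colF]]].
have colG' : colors_small own2 G by move=> i s sG _; apply: colG.
exists (prod_family own1 own2 (own2 \o drop m) F G), (own2 \o drop m); split.
  exact: prod_cube_family.
exact: (prod_colors_small_right m3 n3 famF famG).
Qed.

Lemma colorable_combination a b : 0 < a + b -> colorable (a * 14 + b * 11).
Proof.
have g11 c : colorable (c.+1 * 11).
  elim: c => [|c IH].
    exists (family_of scds11), own11; split; first exact: family11.
    by move=> i s sF _; apply: colors11.
  rewrite mulSnr; exact: (colorable_add _ _ family11 colors11 IH).
elim: a => [|a IH ab]; first by case: b => // b _; apply: g11.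
have [ab0|] := posnP (a + b).
  have [-> ->] : a = 0 /\ b = 0 by lia.
  exists (family_of scds14), own14; split; first exact: family14.
  by move=> i s sF _; apply: colors14.
move=> ab1; have -> : a.+1 * 14 + b * 11 = a * 14 + b * 11 + 14 by lia.
by apply: colorable_add family14 colors14 (IH ab1) => //; lia.
Qed.

Lemma family_exists n : 60 <= n ->
  exists F : 'I_4 -> seq (seq bitseq), cube_family n F.
Proof.
(* [2] is the inverse of [11] modulo [7], so [7] divides [n - 11 * b]. No truncation occurs:
   [59 = 7 * 11 - 7 - 11] is the largest integer not of the form [7 a + 11 b]. *)
move=> n60; pose b := (2 * n) %% 7; pose a := (n - 11 * b) %/ 7.
have Ea : n = a * 7 + b * 11 by rewrite /a /b; lia.
pose e := a %% 2; have [e0|e1] : e = 0 \/ e = 1 by rewrite /e; lia.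
  have [] := @colorable_combination (a %/ 2) b; first by lia.
  move=> F [_ [famF _]]; exists F.
  by have -> : n = a %/ 2 * 14 + b * 11 by rewrite /e in e0; lia.
(* For odd [a] one [Q_7] is left over; as the last factor it only has to provide colours on its
   small chains. *)
have [] := @colorable_combination (a %/ 2) b; first by rewrite /e in e1; lia.
move=> F [own [famF colF]]; exists (prod_family own own7 own F (family_of scds7)).
have -> : n = a %/ 2 * 14 + b * 11 + 7 by rewrite /e in e1; lia.
by apply: prod_cube_family => //; [lia | exact: family7 | exact: colors7].
Qed.

(** * From bit sequences to sets *)

Lemma uniq_flatten_inj (A : eqType) (D : seq (seq A)) s t u :
  uniq (flatten D) -> s \in D -> t \in D -> u \in s -> u \in t -> s = t.
Proof.
elim: D => //= r D IH; rewrite cat_uniq => /and3P[_ /hasPn rD uD].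
have no v w : w \in D -> v \in w -> v \in r -> False.
  by move=> wD vw vr; have /rD/negP : v \in flatten D by apply/flattenP; exists w.
rewrite !inE => /orP[/eqP->|sD] /orP[/eqP->|tD] us ut //.
- by case: (no u t).
- by case: (no u s).
- exact: IH.
Qed.

Lemma uniq_of_flatten (A : eqType) (D : seq (seq A)) :
  {in D, forall s, s != [::]} -> uniq (flatten D) -> uniq D.
Proof.
elim: D => //= s D IH nD; rewrite cat_uniq => /and3P[us /hasPn sD uD].
rewrite IH // ?andbT; last by move=> t tD; apply: nD; rewrite inE tD orbT.
apply/negP => sinD; have := nD s (mem_head _ _); case: s sinD sD {us nD} => // u s sinD sD _.
have /sD/negP[] : u \in flatten D by apply/flattenP; exists (u :: s); rewrite ?mem_head.
exact: mem_head.
Qed.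

Lemma count_flatten_le (A : eqType) (a : pred A) (L : seq (seq A)) :
  {in L, forall s, count a s <= 1} -> count a (flatten L) <= size L.
Proof.
elim: L => //= s L IH H; rewrite count_cat -add1n leq_add ?H ?mem_head //.
by apply: IH => t tL; apply: H; rewrite inE tL orbT.
Qed.

Lemma count_flatten_eq (A : eqType) (a : pred A) (L : seq (seq A)) :
  {in L, forall s, count a s = 1} -> count a (flatten L) = size L.
Proof.
elim: L => //= s L IH H; rewrite count_cat H ?mem_head // add1n IH // => t tL.
by apply: H; rewrite inE tL orbT.
Qed.

Section ToSets.
Variable n : nat.
Implicit Types (u v : bitseq) (s t : seq bitseq) (D : seq (seq bitseq)).

Definition to_set u : {set 'I_n} := [set i : 'I_n | nth false u i].

Lemma card_to_set u : size u = n -> #|to_set u| = count id u.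
Proof.
move=> su; rewrite cardE /enum_mem size_filter -enumT.
rewrite -[in RHS](mkseq_nth false u) /mkseq count_map su -val_enum_ord count_map.
by apply: eq_count => i; rewrite /= inE.
Qed.

Lemma to_set_inj u v : size u = n -> size v = n -> to_set u = to_set v -> u = v.
Proof.
move=> su sv /setP E; apply: (@eq_from_nth _ false); rewrite su // => i lt_in.
by have := E (Ordinal lt_in); rewrite !inE.
Qed.

Lemma subset_to_set u v : all2 implb u v -> to_set u \subset to_set v.
Proof.
move=> uv; apply/subsetP=> i; rewrite !inE; move: (val i) => j.
elim: u v uv j => [|a u IH] [|b v] //= /andP[ab /IH H] [|j] //=; last exact: H.
by case: a b ab => [] [].
Qed.

Lemma to_set_surj (A : {set 'I_n}) : exists2 u, size u = n & A = to_set u.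
Proof.
exists [seq i \in A | i <- enum 'I_n]; first by rewrite size_map size_enum_ord.
apply/setP=> i; rewrite inE (nth_map i) ?size_enum_ord //.
by rewrite nth_ord_enum.
Qed.

Definition set_chain s : {set {set 'I_n}} := [set A in map to_set s].
Definition set_family D : {set {set {set 'I_n}}} := [set C in map set_chain D].

Lemma set_chainP s A : reflect (exists2 u, u \in s & A = to_set u) (A \in set_chain s).
Proof. by rewrite inE; apply: mapP. Qed.

Lemma set_familyP D C : reflect (exists2 s, s \in D & C = set_chain s) (C \in set_family D).
Proof. by rewrite inE; apply: mapP. Qed.

Section Decomposition.
Variable D : seq (seq bitseq).
Hypothesis Dn0 : {in D, forall s, s != [::]}.
Hypothesis uD : uniq (flatten D).
Hypothesis mD : forall u, (u \in flatten D) = (size u == n).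

Lemma decomposition_size s u : s \in D -> u \in s -> size u = n.
Proof. by move=> sD us; apply/eqP; rewrite -mD; apply/flattenP; exists s. Qed.

Lemma set_chain_meet s t A : s \in D -> t \in D ->
  A \in set_chain s -> A \in set_chain t -> s = t.
Proof.
move=> sD tD /set_chainP[u us ->] /set_chainP[v vt /to_set_inj E].
have uv : u = v by apply: E; [apply: decomposition_size us | apply: decomposition_size vt].
by apply: uniq_flatten_inj uD sD tD us _; rewrite uv.
Qed.

Lemma set_family_partition : partition (set_family D) [set: {set 'I_n}].
Proof.
apply/and3P; split.
- apply/eqP/setP=> A; rewrite inE; apply/bigcupP.
  have [u /eqP su ->] := to_set_surj A; move: su; rewrite -mD => /flattenP[s sD us].
  by exists (set_chain s); [apply/set_familyP; exists s | apply/set_chainP; exists u].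
- apply/trivIsetP=> _ _ /set_familyP[s sD ->] /set_familyP[t tD ->] st.
  rewrite -setI_eq0; apply: contraR st => /set0Pn[A] /setIP[As At].
  by rewrite (set_chain_meet sD tD As At).
- apply/negP => /set_familyP[s sD /esym s0]; have := Dn0 sD; case: s s0 sD => // u s s0 _ _.
  have : to_set u \in set_chain (u :: s) by apply/set_chainP; exists u; rewrite ?mem_head.
  by rewrite s0 inE.
Qed.

Lemma card_set_family : #|set_family D| = size D.
Proof.
rewrite cardsE -[RHS](size_map set_chain); apply/card_uniqP.
rewrite map_inj_in_uniq ?(uniq_of_flatten Dn0 uD) // => s t sD tD E.
have := Dn0 sD; case: s E sD => // u s E sD _.
apply: (@set_chain_meet _ _ (to_set u)) => //; last rewrite -E;
  by apply/set_chainP; exists u; rewrite ?mem_head.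
Qed.

End Decomposition.

Lemma count_rank D r : uniq (flatten D) -> (forall u, (u \in flatten D) = (size u == n)) ->
  count (fun u => count id u == r) (flatten D) = 'C(n, r).
Proof.
move=> uD mD; have := card_draws 'I_n r; rewrite card_ord => <-.
have su u : u \in flatten D -> size u = n by rewrite mD => /eqP.
have uS : uniq (map to_set (flatten D)).
  by rewrite map_inj_in_uniq // => u v /su uu /su vv; apply: to_set_inj.
have pS : perm_eq (map to_set (flatten D)) (enum {set 'I_n}).
  apply: uniq_perm => // [|A]; first exact: enum_uniq.
  rewrite mem_enum; apply/mapP; have [u uu ->] := to_set_surj A.
  by exists u => //; rewrite mD uu.
rewrite cardE /enum_mem size_filter -enumT -(permP pS) count_map.
by apply: eq_in_count => u /su uu; rewrite /= inE card_to_set.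
Qed.

Lemma chain_count_rank s r : cube_chain n s ->
  count (fun u => count id u == r) s = (count id (head [::] s) <= r <= count id (last [::] s)).
Proof.
case: s => // c s /andP[p _]; rewrite -(count_map (count id) (pred1 r)).
rewrite (path_ranks covers_rank p) (last_rank covers_rank p) count_uniq_mem ?iota_uniq //.
by rewrite mem_iota addnS ltnS.
Qed.

(** The end ranks of a chain add up to [n], so every chain meets the middle level exactly once. *)
Lemma scd_size D : cube_scd n D -> size D = 'C(n, n./2).
Proof.
case=> /allP aD uD mD; rewrite -(count_rank _ uD mD); apply/esym/count_flatten_eq => s sD.
have ch := aD _ sD; rewrite chain_count_rank //.
case: s ch {sD} => // c s /andP[p /eqP E].
have := last_rank covers_rank p; rewrite /= => l; rewrite (_ : _ && _ = true) //.
by move: E l; move: (count id _) (count id _) => a b; lia.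
Qed.

(** A chain has at most one element on each level. *)
Lemma scd_size_ge D r : cube_scd n D -> 'C(n, r) <= size D.
Proof.
case=> /allP aD uD mD; rewrite -(count_rank _ uD mD); apply: count_flatten_le => s sD.
by rewrite (chain_count_rank _ (aD _ sD)); case: (_ && _).
Qed.

Lemma scd_nonempty D : cube_scd n D -> {in D, forall s, s != [::]}.
Proof. by case=> /allP aD _ _ s /aD; case: s. Qed.

Lemma set_chain_is_chain s : (forall u v, u \in s -> v \in s -> all2 implb u v || all2 implb v u) ->
  is_chain (set_chain s).
Proof.
move=> H A B /set_chainP[u us ->] /set_chainP[v vs ->].
by case/orP: (H u v us vs) => /subset_to_set -> //; rewrite orbT.
Qed.

Lemma chain_rank_bounds c s u : path covers c s -> u \in c :: s ->
  count id c <= count id u <= count id (last c s).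
Proof.
move=> p /(map_f (count id)); rewrite (path_ranks covers_rank p) mem_iota.
by rewrite (last_rank covers_rank p) addnS ltnS.
Qed.

Lemma scd_sets D : cube_scd n D -> symmetric_chain_decomposition (set_family D).
Proof.
move=> sD; have [/allP aD uD mD] := sD; have nD := scd_nonempty sD.
split; first exact: set_family_partition.
  by rewrite card_set_family // (scd_size sD).
move=> _ /set_familyP[s sinD ->]; have ch := aD _ sinD.
have isch : is_chain (set_chain s).
  by apply: set_chain_is_chain => u v us vs; apply: chain_comparable ch us vs.
have sz u : u \in s -> size u = n by apply: decomposition_size mD _ _ sinD.
have inj := chain_rank_inj ch.
case: s ch isch sz inj {sinD} => // c s ch isch sz inj.
have [p /eqP E] := andP ch; have bd u := @chain_rank_bounds c s u p.
have cc : c \in c :: s by rewrite mem_head.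
have ll : last c s \in c :: s by rewrite mem_last.
split; split=> //.
  exists (count id c), (to_set c), (to_set (last c s)); split.
  - by rewrite -E leq_addr.
  - apply/minsetP; split; first by apply/set_chainP; exists c.
    move=> B /set_chainP[v vs ->] /subset_leq_card; rewrite !card_to_set ?sz // => le.
    by rewrite (inj v c) //; apply/eqP; rewrite eqn_leq le; case/andP: (bd _ vs).
  - apply/maxsetP; split; first by apply/set_chainP; exists (last c s).
    move=> B /set_chainP[v vs ->] /subset_leq_card; rewrite !card_to_set ?sz // => le.
    by rewrite (inj v (last c s)) //; apply/eqP; rewrite eqn_leq le andbT; case/andP: (bd _ vs).
  - by rewrite inE card_to_set ?sz.
  - by rewrite inE card_to_set ?sz // -E addKn.
move=> A B /minsetP[/set_chainP[u us ->] _] /maxsetP[/set_chainP[v vs ->] _] m.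
rewrite !card_to_set ?sz // => /andP[um mv].
have /mapP[w ws Ew] : m \in map (count id) (c :: s).
  rewrite (path_ranks covers_rank p) mem_iota addnS ltnS -(last_rank covers_rank p).
  by case/andP: (bd _ us) => /leq_trans-> //; case/andP: (bd _ vs) => _ /(leq_trans mv)->.
exists (to_set w); first by apply/set_chainP; exists w.
by rewrite inE card_to_set ?sz // -Ew.
Qed.

End ToSets.

(** * Almost-orthogonality of the families of sets *)

Lemma card_set_chain n s : {in s, forall u, size u = n} -> uniq s -> #|set_chain n s| = size s.
Proof.
move=> sz us; rewrite cardsE -[RHS](size_map (to_set n)); apply/card_uniqP.
by rewrite map_inj_in_uniq // => u v /sz uu /sz vv; apply: to_set_inj.
Qed.

Lemma to_set_false n u : count id u = 0 -> size u = n -> to_set n u = set0.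
Proof. by move=> c0 su; apply/eqP; rewrite -cards_eq0 card_to_set // c0. Qed.

Lemma to_set_true n u : count id u = n -> size u = n -> to_set n u = [set: 'I_n].
Proof.
move=> cn su; apply/eqP.
by rewrite eqEcard subsetT cardsT card_ord card_to_set // cn leqnn.
Qed.

(** Two distinct common elements are poles, so [pole_ends] makes both chains full. Any further
    common element is again a pole, that is, the empty or the full set. *)
Lemma family_almost_orthogonal n k (F : 'I_k -> seq (seq bitseq)) i j :
  cube_family n F -> i != j ->
  almost_orthogonal (set_family n (F i)) (set_family n (F j)).
Proof.
move=> [sF oF] ij _ _ /set_familyP[s sF1 ->] /set_familyP[t tF1 ->].
have [/allP ai _ mi] := sF i; have [/allP aj _ mj] := sF j.
case: leqP => [|/card_gt1P[X [Y [Xst Yst XY]]]]; first by left.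
have sz u : u \in s -> size u = n by apply: decomposition_size mi _ _ sF1.
have szt u : u \in t -> size u = n by apply: decomposition_size mj _ _ tF1.
have both Z : Z \in set_chain n s :&: set_chain n t ->
    exists u, [/\ u \in s, u \in t & Z = to_set n u].
  case/setIP=> /set_chainP[u us Zu] /set_chainP[v vt Zv]; exists u; split=> //.
  suff -> : u = v by [].
  by apply: (@to_set_inj n); [apply: sz | apply: szt | rewrite -Zu -Zv].
have [x [xs xt Xx]] := both _ Xst; have [y [ys yt Yy]] := both _ Yst; right.
have xy : x != y by apply: contra XY => /eqP E; rewrite Xx Yy E.
have px : pole x by apply: oF ij sF1 tF1 xs xt ys yt xy.
have py : pole y by apply: oF ij sF1 tF1 ys yt xs xt _; rewrite eq_sym.
have full r : cube_chain n r -> {in r, forall u, size u = n} -> x \in r -> y \in r ->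
    [/\ size r = n.+1, set0 \in set_chain n r & [set: 'I_n] \in set_chain n r].
  case: r => // c r ch szr xr yr.
  have [sr c0 l1 _] := pole_ends ch szr xr yr xy px py.
  split; first by rewrite /= sr.
    by apply/set_chainP; exists c; rewrite ?mem_head // to_set_false // szr ?mem_head.
  by apply/set_chainP; exists (last c r); rewrite ?mem_last // to_set_true // szr ?mem_last.
have [ss s0 s1] := full _ (ai _ sF1) sz xs ys.
have [st t0 t1] := full _ (aj _ tF1) szt xt yt.
rewrite !card_set_chain ?(chain_uniq (ai _ sF1)) ?(chain_uniq (aj _ tF1)) //; split=> //.
apply/setP=> Z; rewrite in_set2; apply/idP/orP; last first.
  by case=> /eqP->; rewrite inE ?s0 ?t0 ?s1 ?t1.
case/both=> z [zs zt ->].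
have : pole z.
  have [->//|zx] := eqVneq z x.
  by apply: oF ij sF1 tF1 zs zt xs xt zx.
rewrite /pole sz // => /orP[]/eqP cz; [left|right]; apply/eqP.
  by rewrite to_set_false ?sz.
by rewrite to_set_true ?sz.
Qed.

(** * Disjoint chains and the transfer of the top element *)

(** Pigeonhole: if every chain met [X], picking a point of [X] on each would inject [D] into [X],
    since the chains are disjoint. *)
Lemma exists_disjoint_chain (A : eqType) (D : seq (seq A)) (X : seq A) :
  {in D, forall s, s != [::]} -> uniq (flatten D) -> size X < size D ->
  exists2 s, s \in D & {in s, forall u, u \notin X}.
Proof.
move=> nD uD lt.
have [/hasP[s sD /allP sX]|/hasPn H] := boolP (has (all [predC X]) D).
  by exists s => // u us; apply: sX.
case: X lt H => [|x0 X] lt H.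
  case: D nD uD lt H => // s D _ _ _ /(_ s (mem_head _ _)) /allPn[u us].
  by [].
pose g s := nth x0 s (find (mem (x0 :: X)) s).
have hg s : s \in D -> g s \in s /\ g s \in x0 :: X.
  move=> sD; have hs : has (mem (x0 :: X)) s.
    by have /allPn[u us] := H s sD; rewrite /= negbK => uX; apply/hasP; exists u.
  by split; [rewrite mem_nth // -has_find | apply: (nth_find x0 hs)].
have ug : uniq (map g D).
  rewrite map_inj_in_uniq ?(uniq_of_flatten nD uD) // => s t sD tD E.
  have [gs _] := hg _ sD; have [gt _] := hg _ tD; rewrite -E in gt.
  exact: uniq_flatten_inj uD sD tD gs gt.
have sub : {subset map g D <= x0 :: X} by move=> _ /mapP[s /hg[_ gX] ->].
by have := uniq_leq_size ug sub; rewrite size_map leqNgt lt.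
Qed.

Lemma size_flatten_leq (I A : eqType) (f : I -> seq A) (L : seq I) M :
  {in L, forall j, size (f j) <= M} -> size (flatten (map f L)) <= size L * M.
Proof.
elim: L => //= j L IH H; rewrite size_cat mulSn leq_add ?H ?mem_head //.
by apply: IH => l lL; apply: H; rewrite inE lL orbT.
Qed.

(** A greedy choice: each stage has to avoid [x] and at most [k] earlier chains of at most [n.+1]
    elements. *)
Lemma exists_disjoint_chains n k (F : 'I_k -> seq (seq bitseq)) (x : bitseq) :
  (forall i, cube_scd n (F i)) -> (forall i, (k * n.+1).+1 < size (F i)) ->
  exists B : 'I_k -> seq bitseq,
    [/\ forall i, B i \in F i, forall i, x \notin B i &
        forall i j u, i != j -> u \in B i -> u \notin B j].
Proof.
move=> sF szF.
have szB i s : s \in F i -> size s <= n.+1.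
  have [/allP aF _ _] := sF i; move=> /aF; case: s => // c s /andP[p /eqP E].
  by have := last_rank covers_rank p; rewrite /= ltnS; lia.
suff H r : r <= k -> exists B : 'I_k -> seq bitseq,
   [/\ forall i : 'I_k, i < r -> B i \in F i, forall i : 'I_k, i < r -> x \notin B i &
       forall i j : 'I_k, i < j < r -> {in B j, forall u, u \notin B i}].
  have [B [BF Bx Bd]] := H k (leqnn k); exists B; split=> [i|i|i j u ij ui].
  - exact: BF.
  - exact: Bx.
  move: ij; rewrite -(inj_eq val_inj) /= neq_ltn => /orP[ij|ji].
    apply/negP => uj; have := Bd i j; rewrite ij ltn_ord => /(_ isT u uj).
    by rewrite ui.
  by have := Bd j i; rewrite ji ltn_ord => /(_ isT u ui).
elim: r => [|r IH] rk; first by exists (fun=> [::]); split=> // i j; rewrite ltn0 andbF.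
have [B [BF Bx Bd]] := IH (ltnW rk); pose ir := Ordinal rk.
pose X := x :: flatten [seq B j | j : 'I_k <- enum 'I_k & j < r].
have szX : size X < size (F ir).
  apply: leq_ltn_trans (szF ir); rewrite /= ltnS.
  have sk : size [seq j : 'I_k <- enum 'I_k | j < r] <= k.
    by rewrite size_filter; apply: leq_trans (count_size _ _) _; rewrite size_enum_ord.
  apply: leq_trans (leq_mul sk (leqnn n.+1)); apply: size_flatten_leq => j.
  by rewrite mem_filter => /andP[jr _]; apply: szB (BF _ jr).
have [_ uF _] := sF ir.
have [b bF bX] := exists_disjoint_chain (scd_nonempty (sF ir)) uF szX.
have Xj (j : 'I_k) u : j < r -> u \in B j -> u \in X.
  move=> jr uj; rewrite inE; apply/orP; right; apply/flattenP.
  by exists (B j) => //; apply: map_f; rewrite mem_filter jr mem_enum.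
exists (fun i => if i == ir then b else B i); split=> [i|i|i j].
- case: eqP => [->|/eqP ir'] //; rewrite ltnS leq_eqVlt.
  by rewrite -[i == r :> nat]/(i == ir) (negbTE ir'); apply: BF.
- case: eqP => [_ _|/eqP ir'].
    by apply/negP => /bX/negP; apply; apply: mem_head.
  by rewrite ltnS leq_eqVlt -[i == r :> nat]/(i == ir) (negbTE ir'); apply: Bx.
move=> /andP[ij jr].
have /negbTE-> : i != ir by rewrite -(inj_eq val_inj) /= neq_ltn (leq_trans ij).
case: eqP => [Ej u ub|/eqP jr'].
  apply/negP => /Xj ui; have /negP := bX u ub; apply; apply: ui.
  by rewrite Ej in ij.
apply: Bd; rewrite ij; move: jr; rewrite ltnS leq_eqVlt.
by rewrite -[j == r :> nat]/(j == ir) (negbTE jr').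
Qed.

Section MoveTop.
Variables (n : nat) (B : seq bitseq) (D : seq (seq bitseq)).
Hypotheses (n0 : 0 < n) (sD : cube_scd n D) (BD : B \in D).

(* [B] receives the top element, which is removed from its own chain. *)
Definition move_top (s : seq bitseq) : seq bitseq :=
  filter (predC1 (nseq n true)) s ++ (if s == B then [:: nseq n true] else [::]).

Lemma mem_move_top s u : (u \in move_top s) =
  (u \in s) && (u != nseq n true) || (u == nseq n true) && (s == B).
Proof.
rewrite mem_cat mem_filter /= andbC; congr (_ || _).
by case: eqP => _; rewrite ?inE ?andbT ?andbF.
Qed.

Lemma perm_move_top : perm_eq (flatten (map move_top D)) (flatten D).
Proof.
have [_ uD mD] := sD; have Bu := uniq_of_flatten (scd_nonempty sD) uD.
set ones := nseq n true.
(* Stated for any [L] to allow induction: the top is removed everywhere and put back once if [B]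
   occurs in [L]. *)
have mv (L : seq (seq bitseq)) : uniq L ->
    perm_eq (flatten (map move_top L))
      (filter (predC1 ones) (flatten L) ++ nseq (B \in L) ones).
  elim: L => //= s L IH /andP[sL uL].
  rewrite filter_cat /move_top -!catA perm_cat2l inE eq_sym.
  case: eqP => [EB|_] /=; last by rewrite IH.
  have BL : (B \in L) = false by rewrite EB; apply/negbTE.
  have := IH uL; rewrite BL cats0 => pL.
  by rewrite perm_sym perm_catC /= perm_cons perm_sym.
apply: perm_trans (mv D Bu) _; rewrite BD.
have on : ones \in flatten D by rewrite mD size_nseq.
apply: uniq_perm => // [|u].
  by rewrite cat_uniq filter_uniq //= orbF mem_filter /= eqxx.
rewrite mem_cat mem_filter mem_seq1 /=.
by case: eqP => [->|_]; rewrite ?on ?orbF.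
Qed.

(** A chain starting at the top would have rank sum at least [n + n]; as [n > 0], its first element
    survives the removal. *)
Lemma move_top_nonempty s : s \in D -> move_top s != [::].
Proof.
have [/allP aD _ _] := sD; move=> /aD; case: s => // c s /andP[p /eqP E].
have c1 : c != nseq n true.
  apply/negP => /eqP Ec; have /andP[le _] := chain_rank_bounds p (mem_last c s).
  move: E le; rewrite Ec count_nseq mul1n; move: (count _ _) => b; lia.
apply/eqP => E0; have : c \in move_top (c :: s) by rewrite mem_move_top mem_head c1.
by rewrite E0.
Qed.

Lemma all2_implb_ones u : size u = n -> all2 implb u (nseq n true).
Proof. by move=> <-; elim: u => //= -[]. Qed.

Lemma move_top_decomposition : chain_decomposition (set_family n (map move_top D)).
Proof.
have [/allP aD uD mD] := sD; have p := perm_move_top.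
have uM : uniq (flatten (map move_top D)) by rewrite (perm_uniq p).
have mM u : (u \in flatten (map move_top D)) = (size u == n) by rewrite (perm_mem p).
have nM : {in map move_top D, forall s, s != [::]}.
  by move=> _ /mapP[s sD' ->]; apply: move_top_nonempty.
split; first exact: set_family_partition.
  by rewrite card_set_family // size_map (scd_size sD).
move=> _ /set_familyP[_ /mapP[s sinD ->] ->]; apply: set_chain_is_chain => u v.
have sz w : w \in s -> size w = n by apply: decomposition_size mD _ _ sinD.
rewrite !mem_move_top => /orP[/andP[us _]|/andP[/eqP-> /eqP Es]]
  /orP[/andP[vs _]|/andP[/eqP-> /eqP Et]].
- exact: chain_comparable (aD _ sinD) us vs.
- by rewrite all2_implb_ones ?sz.
- by rewrite all2_implb_ones ?orbT ?sz.
- by rewrite all2_implb_ones ?size_nseq.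
Qed.

End MoveTop.

(** If the top is common, the chains come from [B i] and [B j], which are disjoint, so nothing else
    is common. Otherwise two distinct common elements would be poles other than the top, hence both
    empty. *)
Lemma move_top_orthogonal n k (F : 'I_k -> seq (seq bitseq)) (B : 'I_k -> seq bitseq) i j :
  cube_family n F -> (forall i, B i \in F i) -> (forall i, nseq n true \notin B i) ->
  (forall i j u, i != j -> u \in B i -> u \notin B j) -> i != j ->
  orthogonal (set_family n (map (move_top n (B i)) (F i)))
             (set_family n (map (move_top n (B j)) (F j))).
Proof.
move=> [sF oF] BF Bx Bd ij _ _ /set_familyP[_ /mapP[s sF1 ->] ->]
  /set_familyP[_ /mapP[t tF1 ->] ->].
have [/allP ai _ mi] := sF i; have [/allP aj _ mj] := sF j.
have sz l r u : r \in F l -> u \in move_top n (B l) r -> size u = n.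
  move=> rF; rewrite mem_move_top => /orP[/andP[ur _]|/andP[/eqP-> _]]; last by rewrite size_nseq.
  by apply: cube_scd_mem (sF l) rF ur.
case: leqP => // /card_gt1P[X [Y [Xst Yst XY]]].
have both Z : Z \in set_chain n (move_top n (B i) s) :&: set_chain n (move_top n (B j) t) ->
    exists u, [/\ u \in move_top n (B i) s, u \in move_top n (B j) t & Z = to_set n u].
  case/setIP=> /set_chainP[u us Zu] /set_chainP[v vt Zv]; exists u; split=> //.
  suff -> : u = v by [].
  by apply: (@to_set_inj n); [apply: sz us | apply: sz vt | rewrite -Zu -Zv].
have [x [xs xt Xx]] := both _ Xst; have [y [ys yt Yy]] := both _ Yst.
have xy : x != y by apply: contra XY => /eqP E; rewrite Xx Yy E.
have top u v : u = nseq n true -> u \in move_top n (B i) s -> u \in move_top n (B j) t ->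
    v \in move_top n (B i) s -> v \in move_top n (B j) t -> u != v -> False.
  rewrite !mem_move_top => ->; rewrite eqxx !andbF /= => /eqP-> /eqP->.
  rewrite !(eq_sym (nseq _ _)) => /orP[/andP[vi v1]|/andP[/eqP-> _]]; last by rewrite eqxx.
  case/orP=> [/andP[vj _] _|/andP[/eqP v1' _]]; last by rewrite v1' eqxx in v1.
  by have := Bd i j v ij vi; rewrite vj.
have [x1|x1] := eqVneq x (nseq n true); first by case: (top x y x1 xs xt ys yt xy).
have [y1|y1] := eqVneq y (nseq n true).
  by rewrite eq_sym in xy; case: (top y x y1 ys yt xs xt xy).
move: xs xt ys yt; rewrite !mem_move_top (negbTE x1) (negbTE y1) !andbT !orbF => xs xt ys yt.
have px : pole x by apply: oF ij sF1 tF1 xs xt ys yt xy.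
have py : pole y by apply: oF ij sF1 tF1 ys yt xs xt _; rewrite eq_sym.
have zero u : u \in s -> u != nseq n true -> pole u -> count id u = 0.
  move=> us u1 /orP[/eqP //|/eqP cu]; case/eqP: u1.
  have su : size u = n by apply: cube_scd_mem (sF i) sF1 us.
  rewrite -su; apply/all_pred1P; move/eqP: cu; rewrite -all_count.
  by apply: sub_all => -[].
case/eqP: xy; apply: (chain_rank_inj (ai _ sF1)) => //.
by rewrite (zero x) ?(zero y).
Qed.

Theorem theorem1 (n : nat) (hn : 60 <= n) :
  (exists D : 'I_4 -> {set {set {set 'I_n}}},
     (forall i, symmetric_chain_decomposition (D i)) /\
     (forall i j, i != j -> almost_orthogonal (D i) (D j))) /\
  (exists D : 'I_4 -> {set {set {set 'I_n}}},
     (forall i, chain_decomposition (D i)) /\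
     (forall i j, i != j -> orthogonal (D i) (D j))).
Proof.
have [F famF] := family_exists hn; have [sF _] := famF.
split.
  exists (fun i => set_family n (F i)); split=> [i|i j ij].
    exact: scd_sets.
  exact: family_almost_orthogonal famF ij.
(* The top and four chains of at most [n.+1] elements may have to be avoided; level 2 already forces
   quadratically many chains. *)
have szF i : (4 * n.+1).+1 < size (F i).
  apply: leq_trans (scd_size_ge 2 (sF i)); rewrite bin2 -divn2; nia.
have [B [BF Bx Bd]] := exists_disjoint_chains (nseq n true) sF szF.
exists (fun i => set_family n (map (move_top n (B i)) (F i))); split=> [i|i j ij].
  by apply: move_top_decomposition => //; lia.
exact: move_top_orthogonal famF BF Bx Bd ij.
Qed.
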